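(* Let $(G,H)$ be a matched pair of Lie groups with Lie algebras $\mathfrak g,\mathfrak h$. Then the trivialized cotangent group of $G\bowtie H$ is a matched pair group: $$(\mathfrak g\bowtie\mathfrak h)^\ast\rtimes(G\bowtie H)\;\cong\;(\mathfrak g^\ast\rtimes H)\bowtie(\mathfrak h^\ast\rtimes G).$$ Furthermore, the mutual actions (a left action of $\mathfrak h^\ast\rtimes G$ on $\mathfrak g^\ast\rtimes H$ and a right action of $\mathfrak g^\ast\rtimes H$ on $\mathfrak h^\ast\rtimes G$) are given by $$(\nu,g)\triangleright(\mu,h)=\Big(\mathrm{Ad}^\ast_g(\mu)-\mathrm{Ad}^\ast_{h^{-1}\triangleleft g^{-1}}\big(\nu+\mu\circ TL_{g^{-1}}\circ T\rho_g\big)\circ TR_{(h^{-1}\triangleleft g^{-1})^{-1}}\circ T\sigma_{h^{-1}\triangleleft g^{-1}},\;(h^{-1}\triangleleft g^{-1})^{-1}\Big),$$ $$(\nu,g)\triangleleft(\mu,h)=\Big(\mathrm{Ad}^\ast_{h^{-1}\triangleleft g^{-1}}\big(\nu+\mu\circ TL_{g^{-1}}\circ T\rho_g\big),\;(h^{-1}\triangleright g^{-1})^{-1}\Big).$$ Accordingly, the product on $(\mathfrak g^\ast\rtimes H)\bowtie(\mathfrak h^\ast\rtimes G)$ is $$\big((\mu_1,h_1),(\nu_1,g_1)\big)\cdot\big((\mu_2,h_2),(\nu_2,g_2)\big)=\Big((\mu_1,h_1)\big((\nu_1,g_1)\triangleright(\mu_2,h_2)\big),\;\big((\nu_1,g_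1)\triangleleft(\mu_2,h_2)\big)(\nu_2,g_2)\Big).$$
   Context: A matched pair of Lie groups is a pair $(G,H)$ of Lie groups with a smooth left action $H\times G\to G$, $(h,g)\mapsto h\triangleright g$, of $H$ on the manifold $G$ and a smooth right action $H\times G\to H$, $(h,g)\mapsto h\triangleleft g$, of $G$ on the manifold $H$, such that $h\triangleright(g_1g_2)=(h\triangleright g_1)\big((h\triangleleft g_1)\triangleright g_2\big)$, $(h_1h_2)\triangleleft g=\big(h_1\triangleleft(h_2\triangleright g)\big)(h_2\triangleleft g)$, $h\triangleright e_G=e_G$, $e_H\triangleleft g=e_H$. The matched pair group $G\bowtie H$ is $G\times H$ with product $(g_1,h_1)(g_2,h_2)=\big(g_1(h_1\triangleright g_2),(h_1\triangleleft g_2)h_2\big)$. Its Lie algebra is denoted $\mathfrak g\bowtie\mathfrak h$; as a vector space it is $\mathfrak g\oplus\mathfrak h$, and $(\mathfrak g\bowtie\mathfrak h)^\ast=\mathfrak g^\ast\oplus\mathfrak h^\ast$ with elements $(\mu,\nu)$. For any Lie group $K$ with Lie algebra $\mathfrak k$, the left coadjoint action is $\langle\mathrm{Ad}^\ast_k\mu,\xi\rangle=\langle\mu,\mathrm{Ad}_{k^{-1}}\xi\rangle$, and the right trivialized cotangent group is $\mathfrak k^\ast\rtimes K$ with product $(\mu_1,k_1)(\mu_2,k_2)=(\mu_1+\mathrm{Ad}^\ast_{k_1}\mu_2,k_1k_2)$. This is applied with $K=G\bowtie H$. The group $H$ acts on $\mathfrak g$ from the left by $h\triangleright\xi=T_{e_G}\rho_h(\xi)$,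 where $\rho_h:G\to G$, $\rho_h(g)=h\triangleright g$, and $G$ acts on $\mathfrak h$ from the right by $\eta\triangleleft g=T_{e_H}\sigma_g(\eta)$, where $\sigma_g:H\to H$, $\sigma_g(h)=h\triangleleft g$. The dual left actions are $\langle h\overset{\ast}{\triangleright}\mu,\xi\rangle=\langle\mu,h^{-1}\triangleright\xi\rangle$ of $H$ on $\mathfrak g^\ast$, and $\langle g\overset{\ast}{\triangleright}\nu,\eta\rangle=\langle\nu,\eta\triangleleft g\rangle$ of $G$ on $\mathfrak h^\ast$. The semidirect products are $\mathfrak g^\ast\rtimes H$ with $(\mu_1,h_1)(\mu_2,h_2)=(\mu_1+h_1\overset{\ast}{\triangleright}\mu_2,h_1h_2)$, and $\mathfrak h^\ast\rtimes G$ with $(\nu_1,g_1)(\nu_2,g_2)=(\nu_1+g_1\overset{\ast}{\triangleright}\nu_2,g_1g_2)$. They are regarded as subgroups of $(\mathfrak g\bowtie\mathfrak h)^\ast\rtimes(G\bowtie H)$ via $(\mu,h)\mapsto((\mu,0),(e_G,h))$ and $(\nu,g)\mapsto((0,\nu),(g,e_H))$; the isomorphism in the claim is the multiplication map $\big((\mu,h),(\nu,g)\big)\mapsto((\mu,0),(e_G,h))\cdot((0,\nu),(g,e_H))$. In the formulas for the mutual actions: $L$ and $R$ denote left and right translations; $T\rho_g:\mathfrak h\to T_gG$ is the tangent map at $e_H$ of $\rho_g:H\to G$, $h\mapsto h\triangleright g$; for $k\in H$, $T\sigma_k:\mathfrak g\to T_kH$ is the tangent map at $e_G$ of $\sigma_k:G\to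 H$, $g\mapsto k\triangleleft g$; $TL_{g^{-1}}:T_gG\to\mathfrak g$; $TR_{k^{-1}}:T_kH\to\mathfrak h$; $\mathrm{Ad}^\ast_g$ acts on $\mathfrak g^\ast$ for $g\in G$, and $\mathrm{Ad}^\ast_k$ acts on $\mathfrak h^\ast$ for $k\in H$. For group elements the symbols $\triangleright,\triangleleft$ with $h\in H,g\in G$ are the given actions of the pair $(G,H)$. *)

(* Defs.v *)
From HB Require Import structures.
From mathcomp Require Import all_boot all_order all_algebra.
From mathcomp Require Import all_classical all_reals all_analysis.
Set Implicit Arguments.
Unset Strict Implicit.
Unset Printing Implicit Defensive.
Import Order.TTheory GRing.Theory Num.Theory.
Import numFieldNormedType.Exports.
Local Open Scope classical_set_scope.
Local Open Scope ring_scope.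

(** ** Smooth functions between open subsets of R^m and R^n *)

(* Meant for open U: only the germs of f at the points of U matter. In finite
   dimension, Df is C^k as soon as all the directional derivatives of f are. *)
Fixpoint Ck_on (R : realType) (k m n : nat) (U : set 'rV[R]_m)
    (f : 'rV[R]_m -> 'rV[R]_n) : Prop :=
  match k with
  | 0 => forall x, U x -> {for x, continuous f}
  | k'.+1 => (forall x, U x -> differentiable f x) /\
             (forall v : 'rV[R]_m, Ck_on k' U (fun x => 'D_v f x))
  end.

Definition smooth_on (R : realType) (m n : nat) (U : set 'rV[R]_m)
    (f : 'rV[R]_m -> 'rV[R]_n) : Prop :=
  forall k, Ck_on k U f.

(** ** Manifolds *)

(* A space of dimension [cdim] with, for each point p, a preferred chart
   [cmap p] around p, of domain [cdom p] and inverse [cinv p]; both maps are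
   total, their values outside of the domain (resp. its image) being irrelevant.
   These charts form the atlas. This is data only; see [is_manifold]. *)
Record charted (R : realType) := Charted {
  cpt :> topologicalType;
  cdim : nat;
  cdom : cpt -> set cpt;
  cmap : cpt -> cpt -> 'rV[R]_cdim;
  cinv : cpt -> 'rV[R]_cdim -> cpt
}.
Arguments cdom {R} _ _ _.
Arguments cmap {R} _ _ _.
Arguments cinv {R} _ _ _.

Definition is_chart (R : realType) (M : charted R) (p : M) : Prop :=
  [/\ open (cdom M p), cdom M p p, open (cmap M p @` cdom M p),
      forall x, cdom M p x -> cinv M p (cmap M p x) = x
    & (forall x, cdom M p x -> {for x, continuous (cmap M p)}) /\
      (forall y, (cmap M p @` cdom M p) y -> {for y, continuous (cinv M p)})].

Definition is_manifold (R : realType) (M : charted R) : Prop :=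
  [/\ hausdorff_space M, @second_countable M,
      forall p : M, is_chart p
    & forall p q : M, smooth_on (cmap M p @` (cdom M p `&` cdom M q))
                                (cmap M q \o cinv M p)].

Definition smooth (R : realType) (M N : charted R) (F : M -> N) : Prop :=
  continuous F /\
  forall (p : M) (q : N),
    smooth_on (cmap M p @` (cdom M p `&` F @^-1` cdom N q))
              (cmap N q \o F \o cinv M p).

(* The preferred chart at p identifies T_p M with R^(dim M), so the tangent map
   T_p F : T_p M -> T_(F p) N is the differential of F read in the preferred
   charts at p and at F p. *)
Definition tangent (R : realType) (M N : charted R) (F : M -> N) (p : M) :
    'rV[R]_(cdim M) -> 'rV[R]_(cdim N) :=
  'd (cmap N (F p) \o F \o cinv M p) (cmap M p p).

(* R^(m + n) = R^m (+) R^n: T_(p, q) (M x N) = T_p M (+) T_q N *)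
Definition prodc (R : realType) (M N : charted R) : charted R :=
  @Charted R (M * N)%type (cdim M + cdim N)
    (fun p => cdom M p.1 `*` cdom N p.2)
    (fun p x => row_mx (cmap M p.1 x.1) (cmap N p.2 x.2))
    (fun p v => (cinv M p.1 (lsubmx v), cinv N p.2 (rsubmx v))).

(** ** Dual spaces *)

(* The dual of R^n = 'rV_n is 'cV_n, in the dual basis. In particular the dual
   of R^m (+) R^n is made of the [col_mx mu nu]. *)
Definition pairing (R : realType) (n : nat) (mu : 'cV[R]_n) (xi : 'rV[R]_n) : R :=
  (xi *m mu) 0 0.

(* mu \o T *)
Definition precomp (R : realType) (m n : nat) (mu : 'cV[R]_n)
    (T : 'rV[R]_m -> 'rV[R]_n) : 'cV[R]_m :=
  \col_i pairing mu (T (delta_mx 0 i)).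

Lemma precompE (R : realType) (m n : nat) (mu : 'cV[R]_n)
    (T : {linear 'rV[R]_m -> 'rV[R]_n}) (xi : 'rV[R]_m) :
  pairing (precomp mu T) xi = pairing mu (T xi).
Proof.
rewrite [in RHS](row_sum_delta xi) linear_sum /pairing mulmx_suml summxE mxE.
by apply: eq_bigr => i _; rewrite linearZ -scalemxAl [RHS]mxE [in LHS]mxE.
Qed.

Definition dualc (R : realType) (n : nat) : charted R :=
  @Charted R 'cV[R]_n n (fun=> setT) (fun=> trmx) (fun=> trmx).

(** ** Lie groups *)

Record lieData (R : realType) := LieData {
  lspace :> charted R;
  lone : lspace;
  lmul : lspace -> lspace -> lspace;
  linv : lspace -> lspace
}.
Arguments lone {R} _.
Arguments lmul {R _} _ _.
Arguments linv {R _} _.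

Definition is_lie_group (R : realType) (K : lieData R) : Prop :=
  [/\ is_manifold K,
      associative (@lmul R K),
      left_id (lone K) lmul /\ right_id (lone K) lmul,
      left_inverse (lone K) linv lmul /\ right_inverse (lone K) linv lmul
    & smooth (M := prodc K K) (N := K) (fun xy => lmul xy.1 xy.2) /\
      smooth (M := K) (N := K) linv].

Definition lie_group_iso (R : realType) (K L : lieData R) (f : K -> L) : Prop :=
  {morph f : x y / lmul x y} /\
  exists f' : L -> K, [/\ cancel f f', cancel f' f, smooth f & smooth f'].

(* The underlying vector space T_e K of the Lie algebra of K is
   'rV_(cdim K), and its dual is 'cV_(cdim K). *)
Definition Ad (R : realType) (K : lieData R) (k : K) :
    'rV[R]_(cdim K) -> 'rV[R]_(cdim K) :=
  tangent (M := K) (N := K) (fun x => lmul (lmul k x) (linv k)) (lone K).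

Definition Adstar (R : realType) (K : lieData R) (k : K) (mu : 'cV[R]_(cdim K)) :
    'cV[R]_(cdim K) :=
  precomp mu (Ad (linv k)).

(* (R^n)^* x| K for a left action of K on (R^n)^* *)
Definition semidirect (R : realType) (n : nat) (K : lieData R)
    (a : K -> 'cV[R]_n -> 'cV[R]_n) : lieData R :=
  @LieData R (prodc (dualc R n) K)
    (0, lone K)
    (fun x y => (x.1 + a x.2 y.1, lmul x.2 y.2))
    (fun x => (- a (linv x.2) x.1, linv x.2)).

Definition cotangent_group (R : realType) (K : lieData R) : lieData R :=
  semidirect (@Adstar R K).

(** ** Matched pairs *)

(* [act h g] is h |> g and [ract h g] is h <| g *)
Definition matched_pair (R : realType) (G H : lieData R)
    (act : H -> G -> G) (ract : H -> G -> H) : Prop :=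
  [/\ is_lie_group G /\ is_lie_group H,
      smooth (M := prodc H G) (N := G) (fun x => act x.1 x.2) /\
      smooth (M := prodc H G) (N := H) (fun x => ract x.1 x.2),
      (forall g, act (lone H) g = g) /\
      (forall h1 h2 g, act (lmul h1 h2) g = act h1 (act h2 g)),
      (forall h, ract h (lone G) = h) /\
      (forall h g1 g2, ract h (lmul g1 g2) = ract (ract h g1) g2)
    & [/\ forall h g1 g2, act h (lmul g1 g2) = lmul (act h g1) (act (ract h g1) g2),
          forall h1 h2 g, ract (lmul h1 h2) g = lmul (ract h1 (act h2 g)) (ract h2 g),
          forall h, act h (lone G) = lone G
        & forall g, ract (lone H) g = lone H]].
Arguments matched_pair {R} G H act ract.

(* (g, h)^-1 = (e, h^-1) (g^-1, e) = (h^-1 |> g^-1, h^-1 <| g^-1) *)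
Definition matched_group (R : realType) (G H : lieData R)
    (act : H -> G -> G) (ract : H -> G -> H) : lieData R :=
  @LieData R (prodc G H)
    (lone G, lone H)
    (fun x y => (lmul x.1 (act x.2 y.1), lmul (ract x.2 y.1) y.2))
    (fun x => (act (linv x.2) (linv x.1), ract (linv x.2) (linv x.1))).

Section CotangentOfMatchedPair.
Variables (R : realType) (G H : lieData R).
Variables (act : H -> G -> G) (ract : H -> G -> H).

Local Notation g_ := 'rV[R]_(cdim G) (only parsing).
Local Notation h_ := 'rV[R]_(cdim H) (only parsing).
Local Notation gdual := 'cV[R]_(cdim G) (only parsing).
Local Notation hdual := 'cV[R]_(cdim H) (only parsing).

Definition act_lie (h : H) : g_ -> g_ :=
  tangent (M := G) (N := G) (fun g => act h g) (lone G).

Definition ract_lie (g : G) : h_ -> h_ :=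
  tangent (M := H) (N := H) (fun h => ract h g) (lone H).

Definition dual_act (h : H) (mu : gdual) : gdual := precomp mu (act_lie (linv h)).

Definition dual_ract (g : G) (nu : hdual) : hdual := precomp nu (ract_lie g).

(* g^* x| H *)
Definition gdual_H : lieData R := semidirect dual_act.

(* h^* x| G *)
Definition hdual_G : lieData R := semidirect dual_ract.

(* TL_(g^-1) \o T rho_g, where rho_g : H -> G, rho_g h = h |> g *)
Definition TL_Trho (g : G) : h_ -> g_ :=
  tangent (M := G) (N := G) (fun x => lmul (linv g) x) g \o
  tangent (M := H) (N := G) (fun h => act h g) (lone H).

(* TR_(k^-1) \o T sigma_k, where sigma_k : G -> H, sigma_k g = k <| g *)
Definition TR_Tsigma (k : H) : g_ -> h_ :=
  tangent (M := H) (N := H) (fun x => lmul x (linv k)) k \o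
  tangent (M := G) (N := H) (fun g => ract k g) (lone G).

(* (nu, g) |> (mu, h) *)
Definition cot_act (b : hdual_G) (a : gdual_H) : gdual_H :=
  let: (nu, g) := b in let: (mu, h) := a in
  let k := ract (linv h) (linv g) in
  (Adstar g mu - precomp (Adstar k (nu + precomp mu (TL_Trho g))) (TR_Tsigma k),
   linv k).

(* (nu, g) <| (mu, h) *)
Definition cot_ract (b : hdual_G) (a : gdual_H) : hdual_G :=
  let: (nu, g) := b in let: (mu, h) := a in
  let k := ract (linv h) (linv g) in
  (Adstar k (nu + precomp mu (TL_Trho g)), linv (act (linv h) (linv g))).

Definition incl_gdual_H (a : gdual_H) : cotangent_group (matched_group act ract) :=
  (col_mx a.1 0, (lone G, a.2)).

Definition incl_hdual_G (b : hdual_G) : cotangent_group (matched_group act ract) :=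
  (col_mx 0 b.1, (b.2, lone H)).

Definition mult_map (ab : matched_group cot_act cot_ract) :
    cotangent_group (matched_group act ract) :=
  lmul (incl_gdual_H ab.1) (incl_hdual_G ab.2).

End CotangentOfMatchedPair.

Arguments cot_act {R G H} act ract b a.
Arguments cot_ract {R G H} act ract b a.
Arguments mult_map {R G H} act ract ab.

(* Main.v *)
Require Import Defs.
From HB Require Import structures.
From mathcomp Require Import all_boot all_order all_algebra.
From mathcomp Require Import all_classical all_reals all_analysis.
Set Implicit Arguments.
Unset Strict Implicit.
Unset Printing Implicit Defensive.
Import Order.TTheory GRing.Theory Num.Theory.
Import numFieldNormedType.Exports.
Local Open Scope classical_set_scope.
Local Open Scope ring_scope.

(* Every Lie group K acts on the dual of its Lie algebra by Ad^*, and the partial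
   derivative of a smooth map at a fixed point is smooth in the parameter, so all
   the semidirect products at hand are Lie groups. For K = G |><| H the inclusions
   i of g^* x| H and j of h^* x| G in k^* x| K are morphisms, and i(a) j(b) is a
   diffeomorphism with an explicit inverse. Rewriting j(b) i(a) as
   i(b |> a) j(b <| a) gives the formulas of the mutual actions, and the axioms of
   a matched pair all follow from the uniqueness of this factorization. *)

(** * Calculus of C^k maps *)

(** Tangent maps are read in the chart preferred at the base point, and that chart may jump from one
    point to the next. Smooth dependence of a tangent map on a parameter can therefore be expected
    only when its source and target points stay fixed. [TL_Trho] and [TR_Tsigma] pass through T_g G
    and T_k H, which move. Each is merged into a single tangent map at the unit, of h -> g^-1 (h |>
    g) or of g -> (k <| g) k^-1; both maps send unit to unit. The terms of the formulas come from Ad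
    on K: for (e, h)^-1 and (g, e)^-1 it is block triangular with opposite zero blocks, and the
    off-diagonal blocks are exactly [TR_Tsigma] and [TL_Trho]. Transposition moves them to the other
    summand of the dual. Smoothness of the mutual actions is never checked on their formulas: the
    pair of actions is the product of the cotangent group followed by the smooth inverse of the
    multiplication map. *)

Section CkCalculus.
Variable R : realType.
Implicit Types (k m n p : nat).

Lemma near_eq_diff m n (f g : 'rV[R]_m -> 'rV[R]_n) x :
  (\near x, f x = g x) -> differentiable f x -> differentiable g x.
Proof.
move=> fg df; have fgx : f x = g x by exact: (nbhs_singleton fg).
(* The differential of [f] is the candidate for [g]: near 0 both have the same remainder. Uniqueness
   of the linear part then identifies it with ['d g x]. *)
have e : g \o shift x = cst (g x) + 'd f x +o_ (0 : 'rV[R]_m) id.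
  apply/eqaddoP => eps e0; have := diff_locally df.
  move=> /eqaddoP /(_ _ e0) h; near=> y.
  have -> : (g \o shift x - (cst (g x) + 'd f x)) y =
            (f \o shift x - (cst (f x) + 'd f x)) y.
    rewrite !fctE /= fgx; congr (_ - _); apply/esym.
    near: y; have := fg; rewrite (near_shift 0 x) /= subr0; exact.
  by near: y.
have dgf := diff_unique (diff_continuous df) e.
apply/diff_locallyP; split.
  by rewrite dgf; exact: diff_continuous df.
by rewrite dgf; exact: e.
Unshelve. all: by end_near. Qed.

Lemma near_eq_diffE m n (f g : 'rV[R]_m -> 'rV[R]_n) x :
  (\near x, f x = g x) -> differentiable f x -> 'd f x = 'd g x :> (_ -> _).
Proof.
move=> fg df; apply/funext => v.
have dg := near_eq_diff fg df.
transitivity ('D_v f x); first exact: (esym (deriveE v df)).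
transitivity ('D_v g x); last exact: (deriveE v dg).
exact: near_eq_derive.
Qed.

Lemma open_near (T : topologicalType) (U : set T) (x : T) :
  open U -> U x -> nbhs x U.
Proof. by move=> oU Ux; exact: open_nbhs_nbhs. Qed.

Lemma Ck_on_eq k m n (U : set 'rV[R]_m) (f g : 'rV[R]_m -> 'rV[R]_n) :
  open U -> (forall x, U x -> f x = g x) -> Ck_on k U f -> Ck_on k U g.
Proof.
move=> oU; elim: k f g => [|k IH] f g fg /=.
  move=> fc x Ux; have fgx : \near x, f x = g x.
    by apply: filterS (open_near oU Ux) => y; exact: fg.
  suff : g @ x --> f x by rewrite (fg x Ux).
  by apply: cvg_trans (fc x Ux); exact: (near_eq_cvg fgx).
have fgx x : U x -> \near x, f x = g x.
  by move=> Ux; apply: filterS (open_near oU Ux) => y; exact: fg.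
move=> [df Df]; split=> [x Ux|v]; first exact: near_eq_diff (fgx x Ux) (df x Ux).
by apply: IH (Df v) => x Ux; exact/near_eq_derive/fgx.
Qed.

Lemma Ck_onS k m n (U : set 'rV[R]_m) (f : 'rV[R]_m -> 'rV[R]_n) :
  Ck_on k.+1 U f -> Ck_on k U f.
Proof.
elim: k f => [|k IH] f [df Df]; first by move=> x Ux; exact/differentiable_continuous/df.
by split=> // v; apply: IH; exact: Df.
Qed.

(** Iterated directional derivatives are total functions, so at every order the condition is a
    conjunction over the points of [U]. Restriction to smaller sets and gluing both go through
    singletons. *)
Lemma Ck_on_points k m n (U : set 'rV[R]_m) (f : 'rV[R]_m -> 'rV[R]_n) :
  Ck_on k U f <-> forall x, U x -> Ck_on k [set x] f.
Proof.
elim: k f => [|k IH] f /=.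
  by split=> [h x Ux _ -> | h x Ux]; [exact: h|exact: (h x Ux x)].
split=> [[df Df] x Ux|h].
  split=> [_ -> |v]; first exact: df.
  exact: (proj1 (IH _) (Df v)).
split=> [x Ux|v]; first exact: (h x Ux).1.
by apply/IH => x Ux; exact: (h x Ux).2.
Qed.

Lemma Ck_on_cst k m n (U : set 'rV[R]_m) (c : 'rV[R]_n) : Ck_on k U (cst c).
Proof.
elim: k c => [|k IH] c /=; first by move=> x _; exact: cst_continuous.
split=> [x _|v]; first exact: differentiable_cst.
by under eq_fun do rewrite derive_cst; exact: IH.
Qed.

Lemma derive_coord m n (f : 'rV[R]_m -> 'rV[R]_n) x v i :
  derivable f x v -> 'D_v (fun y => f y 0 i) x = 'D_v f x 0 i.
Proof. by move=> df; rewrite derive_mx // mxE. Qed.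

Lemma differentiable_entry m n (f : 'rV[R]_m -> 'rV[R]_n) x i :
  differentiable f x -> differentiable (fun y => f y 0 i : R) x.
Proof.
move=> df; have := @differentiable_comp R _ _ _ f (fun N => N 0 i : R) x df.
by apply; exact: differentiable_coord.
Qed.

(** The scalar factor is a coordinate of a row-valued map because [Ck_on] speaks of row-valued maps
    only. Expanding [g] on the basis leaves scalar products times constant vectors. *)
Lemma differentiable_scale m p n (f : 'rV[R]_m -> 'rV[R]_p)
    (g : 'rV[R]_m -> 'rV[R]_n) i x :
  differentiable f x -> differentiable g x ->
  differentiable (fun y => f y 0 i *: g y) x.
Proof.
move=> df dg.
have -> : (fun y => f y 0 i *: g y) =
    \sum_j (fun y => (f y 0 i * g y 0 j) *: delta_mx 0 j).
  apply/funext => y; rewrite fct_sumE [g y in LHS]row_sum_delta scaler_sumr.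
  by apply: eq_bigr => j _; rewrite scalerA.
apply: differentiable_sum => j.
apply: (@differentiableZl _ _ _ (fun y => f y 0 i * g y 0 j)).
by apply: differentiableM; exact: differentiable_entry.
Qed.

Lemma derive_scale m p n (f : 'rV[R]_m -> 'rV[R]_p)
    (g : 'rV[R]_m -> 'rV[R]_n) i x v :
  differentiable f x -> differentiable g x ->
  'D_v (fun y => f y 0 i *: g y) x =
    'D_v f x 0 i *: g x + f x 0 i *: 'D_v g x.
Proof.
move=> df dg; have dfg := differentiable_scale i df dg.
apply/rowP => j; rewrite derive_mx ?mxE; last exact: diff_derivable.
rewrite -!derive_coord; try exact: diff_derivable.
have -> : (fun y => (f y 0 i *: g y) 0 j) = (fun y => f y 0 i) * (fun y => g y 0 j).
  by apply/funext => y; rewrite !mxE.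
rewrite deriveM; [|exact/diff_derivable/differentiable_entry..].
by rewrite addrC; congr (_ + _); rewrite /GRing.scale /= mulrC.
Qed.

Lemma Ck_onD k m n (U : set 'rV[R]_m) (f g : 'rV[R]_m -> 'rV[R]_n) :
  open U -> Ck_on k U f -> Ck_on k U g -> Ck_on k U (fun x => f x + g x).
Proof.
move=> oU; elim: k f g => [|k IH] f g /=.
  by move=> fc gc x Ux; apply: continuousD; [exact: fc|exact: gc].
move=> [df Df] [dg Dg]; split=> [x Ux|v].
  by apply: differentiableD; [exact: df|exact: dg].
apply: (Ck_on_eq oU _ (IH _ _ (Df v) (Dg v))) => x Ux.
by rewrite deriveD //; apply: diff_derivable; [exact: df|exact: dg].
Qed.

Lemma Ck_on_sum k m n q (U : set 'rV[R]_m) (f : 'I_q -> 'rV[R]_m -> 'rV[R]_n) :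
  open U -> (forall i, Ck_on k U (f i)) -> Ck_on k U (fun x => \sum_i f i x).
Proof.
move=> oU; elim: q f => [|q IH] f hf.
  by under eq_fun do rewrite big_ord0; exact: (Ck_on_cst k U 0).
under eq_fun do rewrite big_ord_recl.
by apply: (Ck_onD oU) => //; apply: IH => i; exact: hf.
Qed.

Lemma Ck_on_scale k m p n (U : set 'rV[R]_m) (f : 'rV[R]_m -> 'rV[R]_p)
    (g : 'rV[R]_m -> 'rV[R]_n) i :
  open U -> Ck_on k U f -> Ck_on k U g -> Ck_on k U (fun x => f x 0 i *: g x).
Proof.
move=> oU; elim: k f g => [|k IH] f g.
  move=> fc gc x Ux; apply: continuousZ; last exact: gc.
  apply: (@continuous_comp _ _ _ f (fun N => N 0 i)); first exact: fc.
  exact: coord_continuous.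
move=> hf hg; have [df Df] := hf; have [dg Dg] := hg; split=> [x Ux|v].
  by apply: differentiable_scale; [exact: df|exact: dg].
have h : Ck_on k U (fun x => 'D_v f x 0 i *: g x + f x 0 i *: 'D_v g x).
  apply: (Ck_onD oU).
    exact: (IH ('D_v f) g (Df v) (Ck_onS hg)).
  exact: (IH f ('D_v g) (Ck_onS hf) (Dg v)).
apply: (Ck_on_eq oU _ h) => x Ux.
by rewrite derive_scale //; [exact: df|exact: dg].
Qed.

(** By the chain rule, the derivative of [g \o f] along v is that of [g] in a direction that varies
    with x. Linearity in the direction rewrites it with the fixed basis directions, whose
    derivatives fall under the induction hypothesis. *)
Lemma Ck_on_comp k m n p (U : set 'rV[R]_m) (V : set 'rV[R]_n)
    (f : 'rV[R]_m -> 'rV[R]_n) (g : 'rV[R]_n -> 'rV[R]_p) :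
  open U -> (forall x, U x -> V (f x)) ->
  Ck_on k U f -> Ck_on k V g -> Ck_on k U (g \o f).
Proof.
move=> oU UV; elim: k g => [|k IH] g.
  move=> fc gc x Ux; apply: continuous_comp; first exact: fc.
  by apply: gc; exact: UV.
move=> hf hg; have [df Df] := hf; have [dg Dg] := hg; split=> [x Ux|v].
  by apply: differentiable_comp; [exact: df|apply/dg/UV].
have h : Ck_on k U (fun x => \sum_i 'D_v f x 0 i *: ('D_(delta_mx 0 i) g \o f) x).
  apply: (Ck_on_sum oU) => i; apply: (Ck_on_scale i oU); first exact: Df.
  exact: (IH ('D_(delta_mx 0 i) g) (Ck_onS hf) (Dg _)).
apply: (Ck_on_eq oU _ h) => x Ux.
have dgf : differentiable g (f x) by exact/dg/UV.
rewrite [RHS]deriveE; last exact: differentiable_comp (df x Ux) dgf.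
rewrite (diff_comp (df x Ux) dgf) /= -(deriveE v (df x Ux)).
rewrite [in RHS](row_sum_delta ('D_v f x)) linear_sum.
by apply: eq_bigr => i _; rewrite linearZ (deriveE _ dgf).
Qed.

Lemma linear_rV_continuous m n (f : {linear 'rV[R]_m -> 'rV[R]_n}) :
  continuous f.
Proof.
have -> : (f : 'rV[R]_m -> 'rV[R]_n) =
    \sum_i (fun x : 'rV[R]_m => x 0 i *: f (delta_mx 0 i)).
  apply/funext => x; rewrite [x in LHS]row_sum_delta linear_sum fct_sumE.
  by apply: eq_bigr => i _; rewrite linearZ.
move=> x; pose F i (y : 'rV[R]_m) := y 0 i *: f (delta_mx 0 i).
have dF i : differentiable (F i) x.
  rewrite /F; apply: (@differentiableZl R _ _ (fun y : 'rV[R]_m => y 0 i : R)).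
  exact: differentiable_coord.
exact: differentiable_continuous (differentiable_sum dF).
Qed.

Lemma Ck_on_linear k m n (U : set 'rV[R]_m) (f : {linear 'rV[R]_m -> 'rV[R]_n}) :
  Ck_on k U f.
Proof.
case: k => [|k]; first by move=> x _; exact: linear_rV_continuous.
split=> [x _|v]; first exact/linear_differentiable/linear_rV_continuous.
have -> : (fun x => 'D_v f x) = cst (f v).
  apply/funext => x; rewrite deriveE ?diff_lin //; first exact: linear_rV_continuous.
  exact/linear_differentiable/linear_rV_continuous.
exact: Ck_on_cst.
Qed.

End CkCalculus.

(** * Germs of smooth maps at a point *)

Section SmoothAt.
Variable R : realType.
Implicit Types (m n p : nat).

(** A germ notion, which frees compositions from the bookkeeping of domains. The open neighbourhood
    matters: on a singleton, [Ck_on] only constrains the successive derivatives at that point. *)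
Definition smooth_at m n (f : 'rV[R]_m -> 'rV[R]_n) (x : 'rV[R]_m) : Prop :=
  exists U, [/\ open U, U x & smooth_on U f].

Lemma smooth_at_eq m n (f g : 'rV[R]_m -> 'rV[R]_n) x :
  (\near x, f x = g x) -> smooth_at f x -> smooth_at g x.
Proof.
move=> fg [U [oU Ux sf]].
exists (U `&` [set y | f y = g y]°); split; first exact/openI/open_interior.
  by split=> //; exact: fg.
move=> k; apply: (@Ck_on_eq _ _ _ _ _ f).
- exact/openI/open_interior.
- by move=> y [_] /interior_subset.
- by apply/Ck_on_points => y [Uy _]; have /Ck_on_points := sf k; exact.
Qed.

Lemma smooth_onP m n (U : set 'rV[R]_m) (f : 'rV[R]_m -> 'rV[R]_n) :
  open U -> smooth_on U f <-> forall x, U x -> smooth_at f x.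
Proof.
move=> oU; split=> [sf x Ux|h k]; first by exists U.
apply/Ck_on_points => x /h [V [_ Vx /(_ k) /Ck_on_points]]; exact.
Qed.

Lemma smooth_at_near m n (f : 'rV[R]_m -> 'rV[R]_n) x :
  smooth_at f x -> \forall y \near x, smooth_at f y.
Proof.
move=> [U [oU Ux sf]]; apply: filterS (open_near oU Ux) => y Uy.
by exists U.
Qed.

Lemma smooth_at_continuous m n (f : 'rV[R]_m -> 'rV[R]_n) x :
  smooth_at f x -> {for x, continuous f}.
Proof. by move=> [U [oU Ux /(_ 0%N) h]]; exact: h. Qed.

Lemma smooth_at_diff m n (f : 'rV[R]_m -> 'rV[R]_n) x :
  smooth_at f x -> differentiable f x.
Proof. by move=> [U [oU Ux /(_ 1%N) [h _]]]; exact: h. Qed.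

Lemma smooth_at_derive m n (f : 'rV[R]_m -> 'rV[R]_n) v x :
  smooth_at f x -> smooth_at ('D_v f) x.
Proof.
by move=> [U [oU Ux sf]]; exists U; split=> // k; have [_] := sf k.+1; exact.
Qed.

Lemma smooth_at_comp m n p (f : 'rV[R]_m -> 'rV[R]_n) (g : 'rV[R]_n -> 'rV[R]_p) x :
  smooth_at f x -> smooth_at g (f x) -> smooth_at (g \o f) x.
Proof.
move=> [U [oU Ux sf]] [V [oV Vx sg]].
have oW : open (U `&` f @^-1` V).
  rewrite openE => y [Uy Vy]; apply: filterI; first exact: open_near.
  by apply: (sf 0%N y Uy); exact: open_near.
exists (U `&` f @^-1` V); split=> // k.
apply: (@Ck_on_comp _ _ _ _ _ _ V) => //; first by move=> y [].
by apply/Ck_on_points => y [Uy _]; have /Ck_on_points := sf k; exact.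
Qed.

Lemma smooth_at_op m n p q (op : ('rV[R]_m -> 'rV[R]_n) -> ('rV[R]_m -> 'rV[R]_p) ->
    'rV[R]_m -> 'rV[R]_q) f g x :
  (forall k U, open U -> Ck_on k U f -> Ck_on k U g -> Ck_on k U (op f g)) ->
  smooth_at f x -> smooth_at g x -> smooth_at (op f g) x.
Proof.
move=> h [U [oU Ux sf]] [V [oV Vx sg]].
exists (U `&` V); split=> //; first exact: openI.
by move=> k; apply: h; [exact: openI|apply/Ck_on_points => y [Uy Vy]..];
  [have /Ck_on_points := sf k|have /Ck_on_points := sg k]; exact.
Qed.

Lemma smooth_atD m n (f g : 'rV[R]_m -> 'rV[R]_n) x :
  smooth_at f x -> smooth_at g x -> smooth_at (fun y => f y + g y) x.
Proof.
exact: (@smooth_at_op _ _ _ _ (fun f g y => f y + g y) _ _ _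
  (fun k U oU => @Ck_onD _ _ _ _ _ _ _ oU)).
Qed.

Lemma smooth_at_scale m n p (f : 'rV[R]_m -> 'rV[R]_n) (g : 'rV[R]_m -> 'rV[R]_p) i x :
  smooth_at f x -> smooth_at g x -> smooth_at (fun y => f y 0 i *: g y) x.
Proof.
exact: (@smooth_at_op _ _ _ _ (fun f g y => f y 0 i *: g y) _ _ _
  (fun k U oU => @Ck_on_scale _ _ _ _ _ _ _ _ _ oU)).
Qed.

Lemma smooth_at_linear m n (f : {linear 'rV[R]_m -> 'rV[R]_n}) x : smooth_at f x.
Proof. by exists setT; split=> //; [exact: openT|move=> k; exact: Ck_on_linear]. Qed.

Lemma smooth_at_cst m n (c : 'rV[R]_n) (x : 'rV[R]_m) : smooth_at (fun=> c) x.
Proof. by exists setT; split=> //; [exact: openT|move=> k; exact: Ck_on_cst]. Qed.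

Lemma smooth_at_id m (x : 'rV[R]_m) : smooth_at id x.
Proof. exact: (@smooth_at_linear _ _ idfun). Qed.

Lemma smooth_at_sum m n q (f : 'I_q -> 'rV[R]_m -> 'rV[R]_n) x :
  (forall i, smooth_at (f i) x) -> smooth_at (fun y => \sum_i f i y) x.
Proof.
elim: q f => [|q IH] f hf.
  by under eq_fun do rewrite big_ord0; exact: smooth_at_cst.
under eq_fun do rewrite big_ord_recl.
by apply: smooth_atD => //; apply: IH => i; exact: hf.
Qed.

Lemma smooth_at_lsubmx m n (x : 'rV[R]_(m + n)) : smooth_at lsubmx x.
Proof. exact: smooth_at_linear. Qed.

Lemma smooth_at_rsubmx m n (x : 'rV[R]_(m + n)) : smooth_at rsubmx x.
Proof. exact: smooth_at_linear. Qed.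

(** Juxtaposition is the sum of two linear embeddings, given by right multiplication by [1 0] and
    [0 1]. *)
Lemma smooth_at_row_mx m n p (f : 'rV[R]_m -> 'rV[R]_n) (g : 'rV[R]_m -> 'rV[R]_p) x :
  smooth_at f x -> smooth_at g x -> smooth_at (fun y => row_mx (f y) (g y)) x.
Proof.
move=> sf sg.
have -> : (fun y => row_mx (f y) (g y)) =
    (fun y => (mulmxr (row_mx 1%:M 0) \o f) y + (mulmxr (row_mx 0 1%:M) \o g) y).
  apply/funext => y /=; rewrite !mul_mx_row !mulmx1 !mulmx0 add_row_mx.
  by rewrite addr0 add0r.
apply: smooth_atD; apply: smooth_at_comp => //; exact: smooth_at_linear.
Qed.

End SmoothAt.

(** * Smooth maps in charts *)

Section Topology.

Lemma continuous_for_pair (S T U : topologicalType) (f : S -> T) (g : S -> U) x :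
  {for x, continuous f} -> {for x, continuous g} ->
  {for x, continuous (fun y => (f y, g y))}.
Proof. exact: cvg_pair. Qed.

Lemma hausdorff_prod (S T : topologicalType) :
  hausdorff_space S -> hausdorff_space T -> hausdorff_space (S * T)%type.
Proof.
move=> hS hT [s t] [s' t'] h; congr (_, _).
  apply: hS => A B As Bs.
  have [||[a b] [[Aa _] [Ba _]]] := h (A `*` setT) (B `*` setT); last by exists a.
    by exists (A, setT) => //; split=> //; exact: filterT.
  by exists (B, setT) => //; split=> //; exact: filterT.
apply: hT => A B At Bt.
have [||[a b] [[_ Aa] [_ Ba]]] := h (setT `*` A) (setT `*` B); last by exists b.
  by exists (setT, A) => //; split=> //; exact: filterT.
by exists (setT, B) => //; split=> //; exact: filterT.
Qed.

Lemma open_setX (S T : topologicalType) (A : set S) (B : set T) :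
  open A -> open B -> open (A `*` B).
Proof.
rewrite !openE => oA oB [s t] [/= As Bt].
by exists (A, B) => //; split; [exact: oA|exact: oB].
Qed.

Lemma second_countable_prod (S T : topologicalType) :
  @second_countable S -> @second_countable T -> @second_countable (S * T)%type.
Proof.
move=> [A cA [oA bA]] [B cB [oB bB]].
exists ((fun ab => ab.1 `*` ab.2) @` (A `*` B)).
  exact: (card_le_trans (card_image_le _ _) (countableX cA cB)).
split=> [_ [[a b] [/= Aa Bb] <-]|[s t] D [[U V] [/= Us Vt] UVD]].
  by apply: open_setX; [exact: oA|exact: oB].
have [a [Aa as_] aU] := bA s U Us; have [b [Bb bt] bV] := bB t V Vt.
exists (a `*` b); first by split=> //; exists (a, b).
by move=> [x y] [/= ax by_]; apply: UVD; split; [exact: aU|exact: bV].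
Qed.

(** Open boxes with rational corners form a countable base: the topology is entrywise, and in each
    entry rationals are found on both sides of the given value, inside the given neighbourhood. *)
Lemma second_countable_mx (R : realType) m n : @second_countable 'M[R]_(m, n).
Proof.
pose box (ab : 'M[rat]_(m, n) * 'M[rat]_(m, n)) : set 'M[R]_(m, n) :=
  [set v | forall i j, ratr (ab.1 i j) < v i j < ratr (ab.2 i j)].
exists (range box); first exact: (card_le_trans (card_image_le _ _) (countableP _)).
split=> [_ [[a b] _ <-]|v A [P Pv PA]].
  rewrite openE => v vab; exists (fun i j => `]ratr (a i j), ratr (b i j)[%classic).
    by move=> i j; apply: open_near; [exact: itv_open|rewrite /= in_itv vab].
  by move=> w h i j; have := h i j; rewrite /= in_itv.
have /choice [f hf] : forall ij : 'I_m * 'I_n, exists q : rat * rat,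
    ratr q.1 < v ij.1 ij.2 < ratr q.2 /\
    `]ratr q.1, ratr q.2[%classic `<=` P ij.1 ij.2.
  move=> [i j] /=; have /nbhs_ballP [e /= e0 eP] := Pv i j.
  have [|q] := @rat_in_itvoo R (v i j - e) (v i j); first by rewrite ltrBlDr ltrDl.
  have [|q'] := @rat_in_itvoo R (v i j) (v i j + e); first by rewrite ltrDl.
  rewrite !in_itv /= => /andP[q'1 q'2] /andP[q1 q2]; exists (q, q') => /=.
  rewrite q2 q'1; split=> // x; rewrite /= in_itv /= => /andP[x1 x2]; apply: eP.
  rewrite /ball /= ltr_norml ltrBrDl ltrBlDl; apply/andP; split.
    by rewrite addrC (lt_trans x2).
  by rewrite ltrBlDl -ltrBlDr (lt_trans q1).
exists (box (\matrix_(i, j) (f (i, j)).1, \matrix_(i, j) (f (i, j)).2)).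
  by split; [exists (\matrix_(i, j) (f (i, j)).1, \matrix_(i, j) (f (i, j)).2)|
    move=> i j; rewrite /= !mxE; exact: (hf (i, j)).1].
move=> w hw; apply: PA => i j; apply: (hf (i, j)).2.
by have := hw i j; rewrite /= !mxE in_itv.
Qed.

Lemma trmx_continuous (T : topologicalType) m n :
  continuous (@trmx T m n).
Proof.
move=> M A [P PM PA]; exists (fun i j => P j i).
  by move=> i j; have := PM j i; rewrite mxE.
by move=> N hN; apply: PA => i j; rewrite mxE; exact: hN.
Qed.

Lemma continuous_row_mx (R : realType) (T : topologicalType) m n
    (f : T -> 'rV[R]_m) (g : T -> 'rV[R]_n) x :
  {for x, continuous f} -> {for x, continuous g} ->
  {for x, continuous (fun y => row_mx (f y) (g y))}.
Proof.
move=> fc gc.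
have -> : (fun y => row_mx (f y) (g y)) =
    (fun y => (mulmxr (row_mx 1%:M 0) \o f) y + (mulmxr (row_mx 0 1%:M) \o g) y).
  apply/funext => y /=; rewrite !mul_mx_row !mulmx1 !mulmx0 add_row_mx.
  by rewrite addr0 add0r.
apply: (@continuousD R 'rV[R]_(m + n) T).
  exact: (continuous_comp fc
    (@linear_rV_continuous _ _ _ (mulmxr (row_mx 1%:M 0)) (f x))).
exact: (continuous_comp gc
  (@linear_rV_continuous _ _ _ (mulmxr (row_mx 0 1%:M)) (g x))).
Qed.

End Topology.

(** * Charts, and smoothness of a map at one point *)

Section Charts.
Variable R : realType.
Implicit Types M N P : charted R.

Lemma chart_nearK M (p x : M) : is_chart p -> cdom M p x ->
  \forall y \near x, cinv M p (cmap M p y) = y.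
Proof.
by move=> [od _ _ K _] px; apply: filterS (open_near od px) => y; exact: K.
Qed.

Lemma chart_nearV M (p x : M) : is_chart p -> cdom M p x ->
  \forall y \near cmap M p x, cdom M p (cinv M p y) /\ cmap M p (cinv M p y) = y.
Proof.
move=> [_ _ oi K _] px.
have h : (cmap M p @` cdom M p) (cmap M p x) by exists x.
by apply: filterS (open_near oi h) => _ [z pz <-]; rewrite K.
Qed.

Lemma chart_cinv_continuous M (p x : M) : is_chart p -> cdom M p x ->
  {for cmap M p x, continuous (cinv M p)}.
Proof. by move=> [_ _ _ _ [_ h]] px; apply: h; exists x. Qed.

Lemma chart_cinv_cvg M (p x : M) : is_chart p -> cdom M p x ->
  cinv M p @ cmap M p x --> x.
Proof.
move=> hp px; have := chart_cinv_continuous hp px.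
have [_ _ _ K _] := hp; have e := K _ px.
by rewrite -[X in _ --> X]e.
Qed.

Lemma cvg_nearW (S T : topologicalType) (f : S -> T) (x : S) (y : T) (A : set T) :
  f @ x --> y -> nbhs y A -> \forall z \near x, A (f z).
Proof. by move=> fxy; exact: fxy. Qed.

Lemma chart_open_image M (p : M) (V : set M) : is_chart p -> open V ->
  open (cmap M p @` (cdom M p `&` V)).
Proof.
move=> hp oV; rewrite openE => _ [x [px Vx] <-].
near=> y; exists (cinv M p y); first split.
- by near: y; apply: filterS (chart_nearV hp px) => y [].
- by near: y; apply: (cvg_nearW (chart_cinv_cvg hp px)); exact: open_near.
- by near: y; apply: filterS (chart_nearV hp px) => y [].
Unshelve. all: by end_near. Qed.

(** Only the charts preferred at [p] and at [F p] occur. Continuity at [p] keeps the values of [F]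
    near [p] inside the chart domain at [F p], where the local expression is meaningful. *)
Definition msmooth M N (F : M -> N) (p : M) : Prop :=
  {for p, continuous F} /\
  smooth_at (cmap N (F p) \o F \o cinv M p) (cmap M p p).

Lemma manifold_chart M (p : M) : is_manifold M -> is_chart p.
Proof. by move=> [_ _]. Qed.

Lemma chart_id M (p : M) : is_chart p -> cdom M p p.
Proof. by move=> []. Qed.

Lemma smooth_at_transition M (p q x : M) : is_manifold M ->
  cdom M p x -> cdom M q x -> smooth_at (cmap M q \o cinv M p) (cmap M p x).
Proof.
move=> hM px qx; have hp := manifold_chart p hM; have [oq _ _ _ _] := manifold_chart q hM.
have [_ _ _ /(_ p q) h] := hM.
by exists (cmap M p @` (cdom M p `&` cdom M q)); split=> //;
  [exact: chart_open_image|exists x].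
Qed.

Lemma msmooth_chart M N (F : M -> N) (p x : M) (q : N) :
  is_manifold M -> is_manifold N -> cdom M p x -> cdom N q (F x) ->
  msmooth F x -> smooth_at (cmap N q \o F \o cinv M p) (cmap M p x).
Proof.
move=> hM hN px qFx [cF sF].
have hp := manifold_chart p hM; have hq := manifold_chart q hN.
have hx := manifold_chart x hM; have hFx := manifold_chart (F x) hN.
have Kx : cinv M p (cmap M p x) = x by have [_ _ _ ->] := hp.
have Kxx : cinv M x (cmap M x x) = x by have [_ _ _ -> //] := hx; exact: chart_id.
(* The local expression in arbitrary charts is the one in the charts preferred at [x] and [F x],
   between two transition maps. The inserted charts cancel only near the point, hence the equality
   of germs. *)
apply: (@smooth_at_eq _ _ _ ((cmap N q \o cinv N (F x)) \o
    (cmap N (F x) \o F \o cinv M x) \o (cmap M x \o cinv M p))).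
  have near1 : \forall y \near cmap M p x, cdom M x (cinv M p y).
    apply: (cvg_nearW (chart_cinv_cvg hp px)).
    by have [ox xx _ _ _] := hx; exact: open_near.
  have near2 : \forall y \near cmap M p x, cdom N (F x) (F (cinv M p y)).
    apply: (cvg_nearW (A := F @^-1` cdom N (F x)) (chart_cinv_cvg hp px)); apply: cF.
    by have [ox xx _ _ _] := hFx; exact: open_near.
  near=> y => /=.
  have -> : cinv M x (cmap M x (cinv M p y)) = cinv M p y.
    by have [_ _ _ -> //] := hx; near: y.
  by have [_ _ _ -> //] := hFx; near: y.
apply: smooth_at_comp; first by apply: smooth_at_transition => //; exact: chart_id.
rewrite /= Kx; apply: smooth_at_comp => //=.
by rewrite Kxx; apply: smooth_at_transition => //; exact: chart_id.
Unshelve. all: by end_near. Qed.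

(** Smoothness in all pairs of charts reduces to one pair per point, the other pairs being reached
    through transition maps. This is the form in which smoothness is established below. *)
Lemma smoothP M N (F : M -> N) : is_manifold M -> is_manifold N ->
  smooth F <-> forall p, msmooth F p.
Proof.
move=> hM hN; split=> [[cF sF] p|h].
  split; first exact: cF.
  have hp := manifold_chart p hM; have [oq Fpq _ _ _] := manifold_chart (F p) hN.
  have oU : open (F @^-1` cdom N (F p)) by apply: open_comp => // x _; exact: cF.
  exists (cmap M p @` (cdom M p `&` F @^-1` cdom N (F p))); split=> //.
    exact: chart_open_image.
  by exists p => //; split=> //; exact: chart_id.
have cF : continuous F by move=> p; have [] := h p.
split=> // p q; have hp := manifold_chart p hM; have [oq _ _ _ _] := manifold_chart q hN.
have oU : open (F @^-1` cdom N q) by apply: open_comp => // x _; exact: cF.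
apply/(smooth_onP _ (chart_open_image hp oU)) => _ [x [px qx] <-].
exact: msmooth_chart.
Qed.

Lemma msmooth_comp M N P (F : M -> N) (G : N -> P) p :
  is_chart p -> is_chart (F p) ->
  msmooth F p -> msmooth G (F p) -> msmooth (G \o F) p.
Proof.
move=> hp hFp [cF sF] [cG sG]; split; first exact: continuous_comp.
have K : cinv M p (cmap M p p) = p by have [_ ? _ ->] := hp.
apply: (@smooth_at_eq _ _ _ ((cmap P (G (F p)) \o G \o cinv N (F p)) \o
    (cmap N (F p) \o F \o cinv M p))).
  have : \forall y \near cmap M p p, cdom N (F p) (F (cinv M p y)).
    apply: (cvg_nearW (A := F @^-1` cdom N (F p))
      (chart_cinv_cvg hp (chart_id hp))); apply: cF.
    by have [ox xx _ _ _] := hFp; exact: open_near.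
  by apply: filterS => y h /=; have [_ _ _ ->] := hFp.
by apply: smooth_at_comp => //=; rewrite K.
Qed.

Lemma msmooth_id M (p : M) : is_chart p -> msmooth (@id M) p.
Proof.
move=> hp; split; first exact: cvg_id.
apply: (smooth_at_eq _ (smooth_at_id _)).
by apply: filterS (chart_nearV hp (chart_id hp)) => y [_ /= ->].
Qed.

Lemma msmooth_cst M N (q : N) (p : M) : msmooth (fun _ : M => q) p.
Proof. by split; [exact: cst_continuous|exact: smooth_at_cst]. Qed.

Lemma msmooth_pair M N P (F : M -> N) (G : M -> P) p :
  msmooth F p -> msmooth G p ->
  msmooth (N := prodc N P) (fun x => (F x, G x)) p.
Proof.
move=> [cF sF] [cG sG]; split; first exact: cvg_pair.
exact: smooth_at_row_mx sF sG.
Qed.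

Lemma prodc_chart M N (p : prodc M N) :
  is_chart p.1 -> is_chart p.2 -> is_chart p.
Proof.
case: p => p q /= hp hq; have [op pp oip Kp [cp cpV]] := hp.
have [oq qq oiq Kq [cq cqV]] := hq.
(* As an intersection of preimages under the two projections, the chart image inherits openness, and
   its inverse map continuity, from the factors. *)
have im : cmap (prodc M N) (p, q) @` cdom (prodc M N) (p, q) =
    (lsubmx @^-1` (cmap M p @` cdom M p)) `&` (rsubmx @^-1` (cmap N q @` cdom N q)).
  apply/seteqP; split=> [_ [[x y] [/= px qy] <-]|v [[x px xv] [y qy yv]]].
    by rewrite /= row_mxKl row_mxKr; split; [exists x|exists y].
  by exists (x, y) => //=; rewrite xv yv hsubmxK.
split.
- exact: open_setX.
- by [].
- rewrite im; apply: openI; apply: open_comp => // v _.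
    exact: continuous_lsubmx.
  exact: continuous_rsubmx.
- by move=> [x y] [/= px qy]; rewrite row_mxKl row_mxKr Kp // Kq.
split.
  move=> [x y] [/= px qy]; apply: continuous_row_mx.
    apply: (@continuous_comp _ _ _ fst (cmap M p)); first exact: cvg_fst.
    exact: cp.
  apply: (@continuous_comp _ _ _ snd (cmap N q)); first exact: cvg_snd.
  exact: cq.
rewrite im => v [vp vq]; apply: continuous_for_pair.
  apply: (@continuous_comp _ _ _ lsubmx (cinv M p)); first exact: continuous_lsubmx.
  exact: cpV.
apply: (@continuous_comp _ _ _ rsubmx (cinv N q)); first exact: continuous_rsubmx.
exact: cqV.
Qed.

Lemma prodc_manifold M N : is_manifold M -> is_manifold N -> is_manifold (prodc M N).
Proof.
move=> hM hN; have [HM CM cM sM] := hM; have [HN CN cN sN] := hN.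
have hc (p : prodc M N) : is_chart p by apply: prodc_chart; [exact: cM|exact: cN].
split=> //; [exact: hausdorff_prod|exact: second_countable_prod|].
move=> p q; have [oq _ _ _ _] := hc q.
apply/(smooth_onP _ (chart_open_image (hc p) oq)) => _ [[x y] [[/= px py] [/= qx qy]] <-].
apply: smooth_at_row_mx.
  apply: (@smooth_at_comp _ _ _ _ lsubmx (cmap M q.1 \o cinv M p.1)).
    exact: smooth_at_lsubmx.
  by rewrite row_mxKl; exact: smooth_at_transition.
apply: (@smooth_at_comp _ _ _ _ rsubmx (cmap N q.2 \o cinv N p.2)).
  exact: smooth_at_rsubmx.
by rewrite row_mxKr; exact: smooth_at_transition.
Qed.

Lemma msmooth_fst M N (p : prodc M N) : is_chart p.1 ->
  msmooth (M := prodc M N) (N := M) fst p.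
Proof.
case: p => p q /= hp; split; first exact: cvg_fst.
apply: (smooth_at_eq _ (smooth_at_lsubmx _)).
have h : nbhs (lsubmx (row_mx (cmap M p p) (cmap N q q)))
    [set y | cdom M p (cinv M p y) /\ cmap M p (cinv M p y) = y].
  by rewrite row_mxKl; exact: chart_nearV (chart_id hp).
by apply: filterS
  (cvg_nearW (@continuous_lsubmx R 1 (cdim M) (cdim N) _) h) => v [_ /= ->].
Qed.

Lemma msmooth_snd M N (p : prodc M N) : is_chart p.2 ->
  msmooth (M := prodc M N) (N := N) snd p.
Proof.
case: p => p q /= hq; split; first exact: cvg_snd.
apply: (smooth_at_eq _ (smooth_at_rsubmx _)).
have h : nbhs (rsubmx (row_mx (cmap M p p) (cmap N q q)))
    [set y | cdom N q (cinv N q y) /\ cmap N q (cinv N q y) = y].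
  by rewrite row_mxKr; exact: chart_nearV (chart_id hq).
by apply: filterS
  (cvg_nearW (@continuous_rsubmx R 1 (cdim M) (cdim N) _) h) => v [_ /= ->].
Qed.

Lemma dualc_chart n (p : dualc R n) : is_chart p.
Proof.
have im : cmap (dualc R n) p @` cdom (dualc R n) p = setT.
  by apply/seteqP; split=> // v _; exists v^T => //=; rewrite trmxK.
split.
- exact: openT.
- exact: I.
- by rewrite im; exact: openT.
- by move=> x _; exact: trmxK.
- by split=> x _; exact: trmx_continuous.
Qed.

Lemma dualc_manifold n : is_manifold (dualc R n).
Proof.
split; [exact: norm_hausdorff|exact: second_countable_mx|exact: dualc_chart|].
move=> p q; have -> : cmap (dualc R n) q \o cinv (dualc R n) p = id.
  by apply/funext => v /=; rewrite trmxK.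
by move=> k; exact: (@Ck_on_linear _ _ _ _ _ idfun).
Qed.

(** The target has a single global chart, the transposition. Near [p], [F] is therefore [f] read in
    the chart and transposed back, so its continuity follows from that of [f]. *)
Lemma msmooth_dualc M n (F : M -> dualc R n) (f : 'rV[R]_(cdim M) -> 'rV[R]_n) p :
  is_chart p -> (forall y, (F (cinv M p y))^T = f y) ->
  smooth_at f (cmap M p p) -> msmooth F p.
Proof.
move=> hp Ff sf; have [_ pp _ _ [cp _]] := hp.
split; last first.
  by have -> : cmap (dualc R n) (F p) \o F \o cinv M p = f
    by apply/funext => y; exact: Ff.
have fc : {for p, continuous (trmx \o (f \o cmap M p))}.
  apply: continuous_comp; last exact: trmx_continuous.
  by apply: continuous_comp; [exact: cp|exact: smooth_at_continuous].
have FE : \forall y \near p, (trmx \o (f \o cmap M p)) y = F y.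
  apply: filterS (chart_nearK hp pp) => y Ky /=.
  by rewrite -Ff trmxK Ky.
suff : F @ p --> (trmx \o (f \o cmap M p)) p by rewrite (nbhs_singleton FE).
by apply: cvg_trans fc; exact: (near_eq_cvg FE).
Qed.

Lemma msmooth_dualcP M n (F : M -> dualc R n) p :
  msmooth F p -> smooth_at (fun y => (F (cinv M p y))^T) (cmap M p p).
Proof. by move=> []. Qed.

Lemma msmooth_dualcD M n (F G : M -> dualc R n) p : is_chart p ->
  msmooth F p -> msmooth G p -> msmooth (N := dualc R n) (fun x => F x + G x) p.
Proof.
move=> hp sF sG; apply: (msmooth_dualc hp).
  by move=> y; rewrite linearD /=; reflexivity.
by apply: smooth_atD; exact: msmooth_dualcP.
Qed.

Lemma msmooth_dualcL M m n (F : M -> dualc R m) (L : {linear 'cV[R]_m -> 'cV[R]_n}) p :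
  is_chart p -> msmooth F p -> msmooth (N := dualc R n) (fun x => L (F x)) p.
Proof.
(* [L] conjugated by the chart of the dual, so that it acts on rows and falls under the calculus
   above. *)
move=> hp sF; pose L' v := (L v^T)^T.
have L'lin : linear L' by move=> a u v; rewrite /L' !linearP.
pose L'L : {linear _ -> _} := HB.pack L' (GRing.isLinear.Build _ _ _ _ L' L'lin).
apply: (msmooth_dualc (f := L'L \o (fun y => (F (cinv M p y))^T)) hp).
  by move=> y /=; rewrite /L' trmxK.
apply: smooth_at_comp; first exact: msmooth_dualcP.
exact: smooth_at_linear.
Qed.

End Charts.

(** * Closure properties of globally smooth maps *)

Section SmoothMaps.
Variable R : realType.
Implicit Types M N P Q : charted R.

Lemma smooth_comp M N P (F : M -> N) (G : N -> P) :
  is_manifold M -> is_manifold N -> is_manifold P ->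
  smooth F -> smooth G -> smooth (M := M) (N := P) (fun x => G (F x)).
Proof.
move=> hM hN hP /(smoothP _ hM hN) sF /(smoothP _ hN hP) sG.
apply/(smoothP _ hM hP) => p; apply: (msmooth_comp (F := F) (G := G)) => //;
  exact: manifold_chart.
Qed.

Lemma smooth_pair M N P (F : M -> N) (G : M -> P) :
  is_manifold M -> is_manifold N -> is_manifold P ->
  smooth F -> smooth G -> smooth (M := M) (N := prodc N P) (fun x => (F x, G x)).
Proof.
move=> hM hN hP /(smoothP _ hM hN) sF /(smoothP _ hM hP) sG.
by apply/(smoothP _ hM (prodc_manifold hN hP)) => p; exact: msmooth_pair.
Qed.

Lemma smooth_comp2 M N P Q (F : M -> N) (G : M -> P) (op : N -> P -> Q) :
  is_manifold M -> is_manifold N -> is_manifold P -> is_manifold Q ->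
  smooth (M := prodc N P) (N := Q) (fun x => op x.1 x.2) ->
  smooth F -> smooth G -> smooth (M := M) (N := Q) (fun x => op (F x) (G x)).
Proof.
move=> hM hN hP hQ sop sF sG.
have hNP := prodc_manifold hN hP.
exact: (smooth_comp hM hNP hQ (smooth_pair hM hN hP sF sG) sop).
Qed.

Lemma smooth_id M : is_manifold M -> smooth (@id M).
Proof.
by move=> hM; apply/(smoothP _ hM hM) => p; exact/msmooth_id/manifold_chart.
Qed.

Lemma smooth_cst M N (q : N) :
  is_manifold M -> is_manifold N -> smooth (M := M) (N := N) (fun=> q).
Proof. by move=> hM hN; apply/(smoothP _ hM hN) => p; exact: msmooth_cst. Qed.

Lemma smooth_fst M N : is_manifold M -> is_manifold N ->
  smooth (M := prodc M N) (N := M) fst.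
Proof.
move=> hM hN; apply/(smoothP _ (prodc_manifold hM hN) hM) => p.
exact/msmooth_fst/manifold_chart.
Qed.

Lemma smooth_snd M N : is_manifold M -> is_manifold N ->
  smooth (M := prodc M N) (N := N) snd.
Proof.
move=> hM hN; apply/(smoothP _ (prodc_manifold hM hN) hN) => p.
exact/msmooth_snd/manifold_chart.
Qed.

Lemma smooth_dualcD M n (F G : M -> dualc R n) : is_manifold M ->
  smooth F -> smooth G -> smooth (M := M) (N := dualc R n) (fun x => F x + G x).
Proof.
move=> hM; have hD := @dualc_manifold R n.
move=> /(smoothP _ hM hD) sF /(smoothP _ hM hD) sG; apply/(smoothP _ hM hD) => p.
by apply: msmooth_dualcD => //; exact: manifold_chart.
Qed.

Lemma smooth_dualcL M m n (F : M -> dualc R m) (L : {linear 'cV[R]_m -> 'cV[R]_n}) :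
  is_manifold M -> smooth F -> smooth (M := M) (N := dualc R n) (fun x => L (F x)).
Proof.
move=> hM /(smoothP _ hM (@dualc_manifold R m)) sF.
apply/(smoothP _ hM (@dualc_manifold R n)) => p.
by apply: msmooth_dualcL => //; exact: manifold_chart.
Qed.

End SmoothMaps.

(** * Tangent maps and their transposes *)

Section Tangent.
Variable R : realType.
Implicit Types M N P : charted R.

(** The type of a tangent map does not mention the base points, so the target chart can be taken at
    any point provably equal to [F p]. This is how a family with constant value at a point gets one
    fixed target chart. *)
Lemma tangentE M N (F : M -> N) p q : F p = q ->
  tangent F p = 'd (cmap N q \o F \o cinv M p) (cmap M p p) :> (_ -> _).
Proof. by move=> <-. Qed.

Lemma diff_cmapE M N (F : M -> N) p : is_manifold M -> is_manifold N -> smooth F ->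
  differentiable (cmap N (F p) \o F \o cinv M p) (cmap M p p).
Proof.
move=> hM hN sF; have /(smoothP _ hM hN)/(_ p) [_] := sF.
exact: smooth_at_diff.
Qed.

Lemma tangent_comp M N P (F : M -> N) (G : N -> P) p :
  is_manifold M -> is_manifold N -> is_manifold P -> smooth F -> smooth G ->
  tangent (M := M) (N := P) (fun x => G (F x)) p =
  tangent G (F p) \o tangent F p.
Proof.
move=> hM hN hP sF sG.
have dF := diff_cmapE p hM hN sF; have dG := diff_cmapE (F p) hN hP sG.
have [_ pp _ K _] := manifold_chart p hM.
have [oFp FpFp _ KF _] := manifold_chart (F p) hN.
have E : (cmap N (F p) \o F \o cinv M p) (cmap M p p) = cmap N (F p) (F p).
  by rewrite /= K.
have cF : {for p, continuous F} by have [cF _] := sF; exact: cF.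
(* The two middle charts at [F p] cancel only where [F] stays in their domain, which continuity
   ensures near [p]. *)
have near1 : \forall y \near cmap M p p,
   ((cmap P (G (F p)) \o G \o cinv N (F p)) \o (cmap N (F p) \o F \o cinv M p)) y =
   (cmap P (G (F p)) \o (fun x => G (F x)) \o cinv M p) y.
  have := chart_cinv_cvg (manifold_chart p hM) pp.
  move=> /(cvg_nearW (A := F @^-1` cdom N (F p))) h.
  have := h (cF _ (open_near oFp FpFp)).
  by apply: filterS => y Fy /=; rewrite KF.
rewrite -E in dG; have dGF := differentiable_comp dF dG.
rewrite /tangent -(near_eq_diffE near1 dGF) (diff_comp dF dG).
by rewrite E.
Qed.

Lemma tangent_id M p : is_manifold M -> tangent (@id M) p = id.
Proof.
move=> hM; have [_ pp _ _ _] := manifold_chart p hM.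
have near1 : \forall y \near cmap M p p, id y = (cmap M p \o id \o cinv M p) y.
  by apply: filterS (chart_nearV (manifold_chart p hM) pp) => y [_ /= ->].
rewrite /tangent -(near_eq_diffE near1 (smooth_at_diff (smooth_at_id _))).
exact: (@diff_val _ _ _ _ _ _ _ (is_diff_id _)).
Qed.

Lemma tangent_cst M N (q : N) (p : M) :
  tangent (M := M) (N := N) (fun=> q) p = fun=> 0.
Proof. exact: diff_cst. Qed.

Lemma tangentD M N (F : M -> N) p u v :
  tangent F p (u + v) = tangent F p u + tangent F p v.
Proof. exact: linearD. Qed.

Lemma diff_row_mx m n p (f : 'rV[R]_m -> 'rV[R]_n) (g : 'rV[R]_m -> 'rV[R]_p) x v :
  smooth_at f x -> smooth_at g x ->
  'd (fun y => row_mx (f y) (g y)) x v = row_mx ('d f x v) ('d g x v).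
Proof.
move=> sf sg; have dh := smooth_at_diff (smooth_at_row_mx sf sg).
rewrite -[LHS]hsubmxK; congr row_mx.
  have e : f = lsubmx \o (fun y => row_mx (f y) (g y)).
    by apply/funext => y /=; rewrite row_mxKl.
  rewrite [in RHS]e diff_comp //; last exact: differentiable_lsubmx.
  by rewrite /= diff_lin //; exact: continuous_lsubmx.
have e : g = rsubmx \o (fun y => row_mx (f y) (g y)).
  by apply/funext => y /=; rewrite row_mxKr.
rewrite [in RHS]e diff_comp //; last exact: differentiable_rsubmx.
by rewrite /= diff_lin //; exact: continuous_rsubmx.
Qed.

Lemma tangent_pair M N P (F : M -> N) (G : M -> P) p v :
  is_manifold M -> is_manifold N -> is_manifold P -> smooth F -> smooth G ->
  tangent (M := M) (N := prodc N P) (fun x => (F x, G x)) p v =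
  row_mx (tangent F p v) (tangent G p v).
Proof.
move=> hM hN hP /(smoothP _ hM hN)/(_ p) [_ sF] /(smoothP _ hM hP)/(_ p) [_ sG].
exact: diff_row_mx.
Qed.

(** The vector is split into its two summands, each being the image of a tangent vector under a
    slice x -> (x, q) or y -> (p, y); the chain rule does the rest. *)
Lemma tangent_prodc M N P (F : prodc M N -> P) (p : M) (q : N) xi eta :
  is_manifold M -> is_manifold N -> is_manifold P -> smooth F ->
  tangent F (p, q) (row_mx xi eta) =
  tangent (M := M) (N := P) (fun x => F (x, q)) p xi +
  tangent (M := N) (N := P) (fun y => F (p, y)) q eta.
Proof.
move=> hM hN hP sF; have hMN := prodc_manifold hM hN.
have -> : row_mx xi eta = row_mx xi 0 + row_mx 0 eta.
  by rewrite add_row_mx addr0 add0r.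
rewrite tangentD.
have si1 : smooth (M := M) (N := prodc M N) (fun x => (x, q)).
  by apply: smooth_pair => //; [exact: smooth_id|exact: smooth_cst].
have si2 : smooth (M := N) (N := prodc M N) (fun y => (p, y)).
  by apply: smooth_pair => //; [exact: smooth_cst|exact: smooth_id].
rewrite (tangent_comp p hM hMN hP si1 sF) (tangent_comp q hN hMN hP si2 sF) /=.
rewrite (tangent_pair p xi hM hM hN (smooth_id hM) (smooth_cst q hM hN)).
rewrite (tangent_pair q eta hN hM hN (smooth_cst p hN hM) (smooth_id hN)).
by rewrite !tangent_id // !tangent_cst.
Qed.

Lemma pairing_precomp_tangent M N (F : M -> N) p mu xi :
  pairing (precomp mu (tangent F p)) xi = pairing mu (tangent F p xi).
Proof. exact: precompE. Qed.

Lemma pairingP n (mu nu : 'cV[R]_n) :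
  (forall xi, pairing mu xi = pairing nu xi) -> mu = nu.
Proof.
move=> h; apply/colP => i; have := h (delta_mx 0 i).
by rewrite /pairing -!rowE !mxE.
Qed.

Lemma pairingE n (mu : 'cV[R]_n) xi : pairing mu xi = \sum_j xi 0 j * mu j 0.
Proof. by rewrite /pairing mxE. Qed.

Lemma pairingDl n (mu nu : 'cV[R]_n) xi :
  pairing (mu + nu) xi = pairing mu xi + pairing nu xi.
Proof. by rewrite /pairing mulmxDr mxE. Qed.

Lemma pairingDr n (mu : 'cV[R]_n) xi eta :
  pairing mu (xi + eta) = pairing mu xi + pairing mu eta.
Proof. by rewrite /pairing mulmxDl mxE. Qed.

Lemma pairing_col_row m n (mu : 'cV[R]_m) (nu : 'cV[R]_n) xi eta :
  pairing (col_mx mu nu) (row_mx xi eta) = pairing mu xi + pairing nu eta.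
Proof. by rewrite /pairing mul_row_col mxE. Qed.

Lemma precompDl m n (mu nu : 'cV[R]_n) (T : 'rV[R]_m -> 'rV[R]_n) :
  precomp (mu + nu) T = precomp mu T + precomp nu T.
Proof. by apply/colP => i; rewrite !mxE pairingDl. Qed.

Lemma precomp_id n (mu : 'cV[R]_n) : precomp mu id = mu.
Proof. by apply/pairingP => xi; rewrite (precompE mu idfun). Qed.

Lemma precomp_comp l m n (mu : 'cV[R]_n) (T : {linear 'rV[R]_m -> 'rV[R]_n})
    (S : 'rV[R]_l -> 'rV[R]_m) :
  precomp mu (T \o S) = precomp (precomp mu T) S.
Proof. by apply/colP => i; rewrite !mxE -precompE. Qed.

(* The tangent spaces at the base points of the family [F (m, -)] do not depend
   on m, so the partial derivative is a map between fixed vector spaces. *)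
Lemma smooth_precomp_tangent M N P (F : M -> N -> P) (n0 : N) (p0 : P) :
  is_manifold M -> is_manifold N -> is_manifold P ->
  smooth (M := prodc M N) (N := P) (fun x => F x.1 x.2) ->
  (forall m, F m n0 = p0) ->
  smooth (M := prodc M (dualc R (cdim P))) (N := dualc R (cdim N))
    (fun x => precomp x.2 (tangent (M := N) (N := P) (F x.1) n0)).
Proof.
move=> hM hN hP sF Fn0.
have hD := @dualc_manifold R (cdim P); have hD' := @dualc_manifold R (cdim N).
have hMD := prodc_manifold hM hD; have hMN := prodc_manifold hM hN.
apply/(smoothP _ hMD hD') => -[m0 mu0].
apply: (msmooth_dualc (manifold_chart _ hMD) (fun=> erefl)).
set x0 := cmap _ _ _; pose v0 := cmap N n0 n0.
(* [F] in fixed charts at [m0], [n0] and [p0]. The target chart serves every [m] near [m0] because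
   [F m n0] is always [p0]. *)
pose Phi := cmap P p0 \o (fun x => F x.1 x.2) \o cinv (prodc M N) (m0, n0).
have sPhi : smooth_at Phi (row_mx (lsubmx x0) v0).
  rewrite row_mxKl; have /(smoothP _ hMN hP)/(_ (m0, n0)) [_] := sF.
  by rewrite /= Fn0.
have srow : smooth_at (fun w : 'rV[R]_(cdim M + cdim P) => row_mx (lsubmx w) v0) x0.
  by apply: smooth_at_row_mx; [exact: smooth_at_lsubmx|exact: smooth_at_cst].
(* The i-th coordinate of the transposed covector is the sum over j of mu_j times the i-th partial
   derivative of Phi_j in the second variable. Written as coordinates scaling constants, it is
   visibly smooth in the parameter and the covector together. *)
apply: (@smooth_at_eq _ _ _ (fun w => \sum_i \sum_j
    'D_(row_mx 0 (delta_mx 0 i)) Phi (row_mx (lsubmx w) v0) 0 j *: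
      ((rsubmx w : 'rV_(cdim P)) 0 j *: delta_mx 0 i))); last first.
  apply: smooth_at_sum => i; apply: smooth_at_sum => j.
  apply: smooth_at_scale.
    apply: (smooth_at_comp (g := 'D_(row_mx 0 (delta_mx 0 i)) Phi) srow).
    exact: smooth_at_derive.
  by apply: smooth_at_scale; [exact: smooth_at_rsubmx|exact: smooth_at_cst].
have := cvg_nearW (smooth_at_continuous srow) (smooth_at_near sPhi).
apply: filterS => w sw.
apply/rowP => i; rewrite summxE [LHS](bigD1 i) //=.
rewrite [X in _ + X = _]big1 ?addr0 => [|k ki]; last first.
  rewrite summxE big1 // => j _; rewrite !mxE eqxx /= eq_sym (negbTE ki).
  by rewrite !mulr0.
rewrite !mxE pairingE summxE; apply: eq_bigr => j _.
rewrite !mxE !eqxx mulr1; congr (_ 0 j * _).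
rewrite (tangentE (Fn0 _)) deriveE; last exact: smooth_at_diff.
have e : cmap P p0 \o F (cinv M m0 (lsubmx w)) \o cinv N n0 =
    Phi \o (fun v => row_mx (lsubmx w) v).
  by apply/funext => v; rewrite /Phi /= row_mxKl row_mxKr.
have srow' : smooth_at (fun v : 'rV[R]_(cdim N) => row_mx (lsubmx w) v) v0.
  by apply: smooth_at_row_mx; [exact: smooth_at_cst|exact: smooth_at_id].
rewrite e (diff_comp (smooth_at_diff srow') (smooth_at_diff sw)) /=.
rewrite (diff_row_mx _ (smooth_at_cst _ _) (smooth_at_id _)).
by rewrite diff_cst diff_val.
Qed.

End Tangent.

(** * Lie groups *)

Section LieGroup.
Variables (R : realType) (K : lieData R).
Hypothesis hK : is_lie_group K.

Lemma lie_manifold : is_manifold K. Proof. by case: hK. Qed.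
Lemma lmulA : associative (@lmul R K). Proof. by case: hK. Qed.
Lemma lmul1 (x : K) : lmul (lone K) x = x. Proof. by case: hK => _ _ []. Qed.
Lemma lmulr1 (x : K) : lmul x (lone K) = x. Proof. by case: hK => _ _ []. Qed.
Lemma lmulV (x : K) : lmul (linv x) x = lone K. Proof. by case: hK => _ _ _ []. Qed.
Lemma lmulrV (x : K) : lmul x (linv x) = lone K. Proof. by case: hK => _ _ _ []. Qed.

Lemma lmulK (x y : K) : lmul (lmul x y) (linv y) = x.
Proof. by rewrite -lmulA lmulrV lmulr1. Qed.
Lemma lmulVK (x y : K) : lmul (linv x) (lmul x y) = y.
Proof. by rewrite lmulA lmulV lmul1. Qed.

Lemma lmul_eq1 (x y : K) : lmul x y = lone K -> y = linv x.
Proof. by move=> h; rewrite -(lmulVK x y) h lmulr1. Qed.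

Lemma linvK (x : K) : linv (linv x) = x.
Proof. by rewrite -(lmul_eq1 (lmulV x)). Qed.
Lemma linv1 : linv (lone K) = lone K.
Proof. by rewrite -(lmul_eq1 (lmul1 (lone K))). Qed.
Lemma linvM (x y : K) : linv (lmul x y) = lmul (linv y) (linv x).
Proof. by apply/esym/lmul_eq1; rewrite lmulA lmulK lmulrV. Qed.

Lemma smooth_lmul (M : charted R) (F G : M -> K) : is_manifold M ->
  smooth F -> smooth G -> smooth (M := M) (N := K) (fun x => lmul (F x) (G x)).
Proof.
move=> hM; have hK' := lie_manifold; have [_ _ _ _ [sm _]] := hK.
exact: (smooth_comp2 (op := @lmul R K)).
Qed.

Lemma smooth_linv (M : charted R) (F : M -> K) : is_manifold M ->
  smooth F -> smooth (M := M) (N := K) (fun x => linv (F x)).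
Proof.
move=> hM sF; have hK' := lie_manifold; have [_ _ _ _ [_ si]] := hK.
exact: (smooth_comp hM hK' hK' sF si).
Qed.

End LieGroup.

(** * Semidirect products of a Lie group with a dual space *)

Section SemidirectLie.
Variables (R : realType) (n : nat) (K : lieData R).
Variable a : K -> 'cV[R]_n -> 'cV[R]_n.
Hypothesis hK : is_lie_group K.
Hypothesis aD : forall k mu nu, a k (mu + nu) = a k mu + a k nu.
Hypothesis a1 : forall mu, a (lone K) mu = mu.
Hypothesis aM : forall k1 k2 mu, a (lmul k1 k2) mu = a k1 (a k2 mu).
Hypothesis smooth_a :
  smooth (M := prodc K (dualc R n)) (N := dualc R n) (fun x => a x.1 x.2).

Lemma linear_act0 k : a k 0 = 0.
Proof. by apply: (addrI (a k 0)); rewrite -aD !addr0. Qed.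

Lemma linear_actN k mu : a k (- mu) = - a k mu.
Proof. by apply/eqP; rewrite -addr_eq0 -aD addNr linear_act0. Qed.

Lemma semidirect_lie : is_lie_group (semidirect a).
Proof.
have hM := lie_manifold hK; have hD := @dualc_manifold R n.
have hS := prodc_manifold hD hM; have hSS := prodc_manifold hS hS.
split.
- exact: hS.
- move=> [m1 k1] [m2 k2] [m3 k3]; rewrite /lmul /=.
  by rewrite aD aM addrA (lmulA hK).
- split=> -[m k]; rewrite /lmul /=.
    by rewrite a1 add0r (lmul1 hK).
  by rewrite linear_act0 addr0 (lmulr1 hK).
- split=> -[m k]; rewrite /lmul /lone /=.
    by rewrite addNr (lmulV hK).
  by rewrite linear_actN -aM (lmulrV hK) a1 subrr.
have sf := smooth_fst hS hS; have ss := smooth_snd hS hS.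
have s1 := smooth_fst hD hM; have s2 := smooth_snd hD hM.
split.
  apply: smooth_pair => //.
    apply: smooth_dualcD => //.
      exact: (smooth_comp hSS hS hD sf s1).
    apply: (smooth_comp2 hSS hM hD hD smooth_a).
      exact: (smooth_comp hSS hS hM sf s2).
    exact: (smooth_comp hSS hS hD ss s1).
  apply: (smooth_lmul hK) => //.
    exact: (smooth_comp hSS hS hM sf s2).
  exact: (smooth_comp hSS hS hM ss s2).
have sV := smooth_linv hK hS s2.
apply: smooth_pair => //.
have sN : smooth (M := prodc (dualc R n) K) (N := dualc R n)
    (fun x => a (linv x.2) x.1) by exact: (smooth_comp2 hS hM hD hD smooth_a).
exact: (smooth_dualcL (-%R : {linear 'cV[R]_n -> 'cV[R]_n}) hS sN).
Qed.

End SemidirectLie.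

(** * The coadjoint action and the cotangent group *)

Section Adjoint.
Variables (R : realType).

Lemma tangent_comp_fix (M : charted R) (F G : M -> M) (p : M) :
  is_manifold M -> smooth F -> smooth G -> F p = p ->
  tangent (M := M) (N := M) (fun x => G (F x)) p = tangent G p \o tangent F p.
Proof. by move=> hM sF sG Fp; rewrite (tangent_comp p hM hM hM sF sG) Fp. Qed.

Lemma precomp_tangent_comp_fix (M : charted R) (F G : M -> M) (p : M) mu :
  is_manifold M -> smooth F -> smooth G -> F p = p ->
  precomp mu (tangent (M := M) (N := M) (fun x => G (F x)) p) =
  precomp (precomp mu (tangent G p)) (tangent F p).
Proof. by move=> hM sF sG Fp; rewrite tangent_comp_fix // precomp_comp. Qed.

Variable K : lieData R.
Hypothesis hK : is_lie_group K.

Lemma smooth_conj (k : K) :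
  smooth (M := K) (N := K) (fun x => lmul (lmul k x) (linv k)).
Proof.
have hM := lie_manifold hK; have sid := smooth_id hM.
have sc k' := smooth_cst (M := K) (N := K) k' hM hM.
exact: (smooth_lmul hK hM (smooth_lmul hK hM (sc k) sid) (sc (linv k))).
Qed.

Lemma conj_lone (k : K) : lmul (lmul k (lone K)) (linv k) = lone K.
Proof. by rewrite (lmulr1 hK) (lmulrV hK). Qed.

Lemma Adstar1 mu : Adstar (lone K) mu = mu.
Proof.
rewrite /Adstar /Ad (linv1 hK).
have -> : (fun x => lmul (lmul (lone K) x) (linv (lone K))) = id.
  by apply/funext => x; rewrite (lmul1 hK) (linv1 hK) (lmulr1 hK).
by rewrite (tangent_id _ (lie_manifold hK)) precomp_id.
Qed.

(** Order is reversed twice, by the inverse inside [Adstar] and by transposition, which leaves a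
    left action. Conjugations fix the unit, so the chain rule stays on one tangent space. *)
Lemma AdstarM (k1 k2 : K) mu : Adstar (lmul k1 k2) mu = Adstar k1 (Adstar k2 mu).
Proof.
have hM := lie_manifold hK.
have := precomp_tangent_comp_fix mu hM (smooth_conj (linv k1))
  (smooth_conj (linv k2)) (conj_lone (linv k1)).
rewrite /Adstar /Ad => <-.
congr (precomp mu (tangent (M := K) (N := K) _ _)); apply/funext => x.
by rewrite !(linvM hK) !(linvK hK) !(lmulA hK).
Qed.

Lemma AdstarD (k : K) mu nu : Adstar k (mu + nu) = Adstar k mu + Adstar k nu.
Proof. exact: precompDl. Qed.

Lemma AdstarK (k : K) mu : Adstar (linv k) (Adstar k mu) = mu.
Proof. by rewrite -AdstarM (lmulV hK) Adstar1. Qed.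

Lemma smooth_Adstar :
  smooth (M := prodc K (dualc R (cdim K))) (N := dualc R (cdim K))
    (fun x => Adstar x.1 x.2).
Proof.
have hM := lie_manifold hK; have hD := @dualc_manifold R (cdim K).
have hMM := prodc_manifold hM hM; have hMD := prodc_manifold hM hD.
have sf := smooth_fst hM hM; have ss := smooth_snd hM hM.
have sc : smooth (M := prodc K K) (N := K)
    (fun x => lmul (lmul (linv x.1) x.2) (linv (linv x.1))).
  have sV := smooth_linv hK hMM sf.
  exact: (smooth_lmul hK hMM (smooth_lmul hK hMM sV ss) (smooth_linv hK hMM sV)).
exact: (smooth_precomp_tangent (F := fun k x => lmul (lmul (linv k) x) (linv (linv k)))
  hM hM hM sc (fun k => conj_lone (linv k))).
Qed.

Lemma cotangent_group_lie : is_lie_group (cotangent_group K).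
Proof.
exact: (semidirect_lie hK (@AdstarD) Adstar1 AdstarM smooth_Adstar).
Qed.

End Adjoint.

(** * Matched pairs: the product group and the two dual semidirect products *)

Section MatchedPair.
Variables (R : realType) (G H : lieData R).
Variables (act : H -> G -> G) (ract : H -> G -> H).
Hypothesis hGH : matched_pair G H act ract.

Lemma mp_lieG : is_lie_group G. Proof. by case: hGH => -[]. Qed.
Lemma mp_lieH : is_lie_group H. Proof. by case: hGH => -[]. Qed.
Lemma mp_act1 g : act (lone H) g = g. Proof. by case: hGH => _ _ []. Qed.
Lemma mp_actM h1 h2 g : act (lmul h1 h2) g = act h1 (act h2 g).
Proof. by case: hGH => _ _ []. Qed.
Lemma mp_ract1 h : ract h (lone G) = h. Proof. by case: hGH => _ _ _ []. Qed.
Lemma mp_ractM h g1 g2 : ract h (lmul g1 g2) = ract (ract h g1) g2.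
Proof. by case: hGH => _ _ _ []. Qed.
Lemma mp_act_lmul h g1 g2 : act h (lmul g1 g2) = lmul (act h g1) (act (ract h g1) g2).
Proof. by case: hGH => _ _ _ _ []. Qed.
Lemma mp_ract_lmul h1 h2 g : ract (lmul h1 h2) g = lmul (ract h1 (act h2 g)) (ract h2 g).
Proof. by case: hGH => _ _ _ _ []. Qed.
Lemma mp_act_lone h : act h (lone G) = lone G. Proof. by case: hGH => _ _ _ _ []. Qed.
Lemma mp_ract_lone g : ract (lone H) g = lone H. Proof. by case: hGH => _ _ _ _ []. Qed.

Lemma smooth_act (M : charted R) (F : M -> H) (F' : M -> G) : is_manifold M ->
  smooth F -> smooth F' -> smooth (M := M) (N := G) (fun x => act (F x) (F' x)).
Proof.
have hG := lie_manifold mp_lieG; have hH := lie_manifold mp_lieH => hM.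
by apply: smooth_comp2 => //; case: hGH => _ [].
Qed.

Lemma smooth_ract (M : charted R) (F : M -> H) (F' : M -> G) : is_manifold M ->
  smooth F -> smooth F' -> smooth (M := M) (N := H) (fun x => ract (F x) (F' x)).
Proof.
have hG := lie_manifold mp_lieG; have hH := lie_manifold mp_lieH => hM.
by apply: smooth_comp2 => //; case: hGH => _ [].
Qed.

(** The inverse laws hold because each component folds back, by an action law or a compatibility
    axiom, into h^-1 and g^-1 g acting on one another, or into h h^-1 and g^-1 doing so. *)
Lemma matched_group_lie : is_lie_group (matched_group act ract).
Proof.
have lG := mp_lieG; have lH := mp_lieH.
have hG := lie_manifold lG; have hH := lie_manifold lH.
have hK := prodc_manifold hG hH; have hKK := prodc_manifold hK hK.
split.
- exact: hK.
- move=> [g1 h1] [g2 h2] [g3 h3]; rewrite /lmul /=; congr (_, _).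
    by rewrite mp_act_lmul mp_actM (lmulA lG).
  by rewrite mp_ractM mp_ract_lmul (lmulA lH).
- split=> -[g h]; rewrite /lmul /lone /=.
    by rewrite mp_act1 mp_ract_lone (lmul1 lG) (lmul1 lH).
  by rewrite mp_act_lone mp_ract1 (lmulr1 lG) (lmulr1 lH).
- split=> -[g h]; rewrite /lmul /lone /=; congr (_, _).
  + by rewrite -mp_act_lmul (lmulV lG) mp_act_lone.
  + by rewrite -mp_ractM (lmulV lG) mp_ract1 (lmulV lH).
  + by rewrite -mp_actM (lmulrV lH) mp_act1 (lmulrV lG).
  + by rewrite -mp_ract_lmul (lmulrV lH) mp_ract_lone.
have sf := smooth_fst hK hK; have ss := smooth_snd hK hK.
have s1 := smooth_fst hG hH; have s2 := smooth_snd hG hH.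
have sf1 := smooth_comp hKK hK hG sf s1; have sf2 := smooth_comp hKK hK hH sf s2.
have ss1 := smooth_comp hKK hK hG ss s1; have ss2 := smooth_comp hKK hK hH ss s2.
split.
  apply: smooth_pair => //.
    exact: (smooth_lmul lG hKK sf1 (smooth_act hKK sf2 ss1)).
  exact: (smooth_lmul lH hKK (smooth_ract hKK sf2 ss1) ss2).
have sV1 := smooth_linv lG hK s1; have sV2 := smooth_linv lH hK s2.
exact: (smooth_pair hK hG hH (smooth_act hK sV2 sV1) (smooth_ract hK sV2 sV1)).
Qed.

Lemma smooth_act_r h : smooth (M := G) (N := G) (act h).
Proof.
have hG := lie_manifold mp_lieG; have hH := lie_manifold mp_lieH.
exact: (smooth_act hG (smooth_cst h hG hH) (smooth_id hG)).
Qed.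

Lemma smooth_act_l g : smooth (M := H) (N := G) (fun h => act h g).
Proof.
have hG := lie_manifold mp_lieG; have hH := lie_manifold mp_lieH.
exact: (smooth_act hH (smooth_id hH) (smooth_cst g hH hG)).
Qed.

Lemma smooth_ract_r h : smooth (M := G) (N := H) (ract h).
Proof.
have hG := lie_manifold mp_lieG; have hH := lie_manifold mp_lieH.
exact: (smooth_ract hG (smooth_cst h hG hH) (smooth_id hG)).
Qed.

Lemma smooth_ract_l g : smooth (M := H) (N := H) (fun h => ract h g).
Proof.
have hG := lie_manifold mp_lieG; have hH := lie_manifold mp_lieH.
exact: (smooth_ract hH (smooth_id hH) (smooth_cst g hH hG)).
Qed.

Lemma dual_act1 mu : dual_act act (lone H) mu = mu.
Proof.
rewrite /dual_act /act_lie (linv1 mp_lieH).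
have -> : act (lone H) = id by apply/funext => x; exact: mp_act1.
by rewrite (tangent_id _ (lie_manifold mp_lieG)) precomp_id.
Qed.

Lemma dual_actM h1 h2 mu :
  dual_act act (lmul h1 h2) mu = dual_act act h1 (dual_act act h2 mu).
Proof.
have hG := lie_manifold mp_lieG.
have := precomp_tangent_comp_fix mu hG (smooth_act_r (linv h1))
  (smooth_act_r (linv h2)) (mp_act_lone (linv h1)).
rewrite /dual_act /act_lie => <-.
congr (precomp mu (tangent (M := G) (N := G) _ _)); apply/funext => x.
by rewrite (linvM mp_lieH) mp_actM.
Qed.

Lemma smooth_dual_act :
  smooth (M := prodc H (dualc R (cdim G))) (N := dualc R (cdim G))
    (fun x => dual_act act x.1 x.2).
Proof.
have lG := mp_lieG; have lH := mp_lieH.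
have hG := lie_manifold lG; have hH := lie_manifold lH.
have hHG := prodc_manifold hH hG.
have s : smooth (M := prodc H G) (N := G) (fun x => act (linv x.1) x.2).
  apply: smooth_act => //; last exact: smooth_snd.
  by apply: smooth_linv => //; exact: smooth_fst.
exact: (smooth_precomp_tangent (F := fun h g => act (linv h) g) hH hG hG s
  (fun h => mp_act_lone (linv h))).
Qed.

Lemma gdual_H_lie : is_lie_group (gdual_H act).
Proof.
have aD h mu nu : dual_act act h (mu + nu) = dual_act act h mu + dual_act act h nu.
  exact: precompDl.
exact: (semidirect_lie mp_lieH aD dual_act1 dual_actM smooth_dual_act).
Qed.

Lemma dual_ract1 nu : dual_ract ract (lone G) nu = nu.
Proof.
rewrite /dual_ract /ract_lie.
have -> : (fun h => ract h (lone G)) = id by apply/funext => x; exact: mp_ract1.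
by rewrite (tangent_id _ (lie_manifold mp_lieH)) precomp_id.
Qed.

(** Transposition alone turns the right action of G into a left one; this is why [dual_ract] has no
    inverse while [dual_act] has one. *)
Lemma dual_ractM g1 g2 nu :
  dual_ract ract (lmul g1 g2) nu = dual_ract ract g1 (dual_ract ract g2 nu).
Proof.
have hH := lie_manifold mp_lieH.
have := precomp_tangent_comp_fix nu hH (smooth_ract_l g1)
  (smooth_ract_l g2) (mp_ract_lone g1).
rewrite /dual_ract /ract_lie => <-.
by congr (precomp nu (tangent (M := H) (N := H) _ _)); apply/funext => x;
  rewrite mp_ractM.
Qed.

Lemma smooth_dual_ract :
  smooth (M := prodc G (dualc R (cdim H))) (N := dualc R (cdim H))
    (fun x => dual_ract ract x.1 x.2).
Proof.
have lG := mp_lieG; have lH := mp_lieH.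
have hG := lie_manifold lG; have hH := lie_manifold lH.
have hGH' := prodc_manifold hG hH.
have s : smooth (M := prodc G H) (N := H) (fun x => ract x.2 x.1).
  by apply: smooth_ract => //; [exact: smooth_snd|exact: smooth_fst].
exact: (smooth_precomp_tangent (F := fun g h => ract h g) hG hH hH s mp_ract_lone).
Qed.

Lemma hdual_G_lie : is_lie_group (hdual_G ract).
Proof.
have aD g mu nu : dual_ract ract g (mu + nu) = dual_ract ract g mu + dual_ract ract g nu.
  exact: precompDl.
exact: (semidirect_lie mp_lieG aD dual_ract1 dual_ractM smooth_dual_ract).
Qed.

End MatchedPair.

(** * The cotangent group of a matched pair *)

Section Factorization.
Variables (R : realType) (L A B : lieData R).
Hypotheses (lL : is_lie_group L) (lA : is_lie_group A) (lB : is_lie_group B).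
Variables (i : A -> L) (j : B -> L).
Hypothesis iM : forall a1 a2, i (lmul a1 a2) = lmul (i a1) (i a2).
Hypothesis jM : forall b1 b2, j (lmul b1 b2) = lmul (j b1) (j b2).
Hypothesis ij_inj : forall a1 a2 b1 b2,
  lmul (i a1) (j b1) = lmul (i a2) (j b2) -> a1 = a2 /\ b1 = b2.
Variables (act : B -> A -> A) (ract : B -> A -> B).
Hypothesis jiE : forall b a, lmul (j b) (i a) = lmul (i (act b a)) (j (ract b a)).

(** A multiplicative map sends the unit to an idempotent, and the only idempotent of a group is its
    unit. *)
Lemma factor_lone : i (lone A) = lone L /\ j (lone B) = lone L.
Proof.
have idem (x : L) : lmul x x = x -> x = lone L.
  by move=> xx; rewrite -[LHS](lmulVK lL x) xx (lmulV lL).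
by split; apply: idem; [rewrite -iM (lmul1 lA)|rewrite -jM (lmul1 lB)].
Qed.

Lemma matched_pair_factor :
  smooth (M := prodc B A) (N := A) (fun x => act x.1 x.2) ->
  smooth (M := prodc B A) (N := B) (fun x => ract x.1 x.2) ->
  matched_pair A B act ract.
Proof.
move=> sact sract; have [i1 j1] := factor_lone.
have E1 a : act (lone B) a = a /\ ract (lone B) a = lone B.
  by apply: ij_inj; rewrite -jiE j1 (lmul1 lL) (lmulr1 lL).
have E2 b : act b (lone A) = lone A /\ ract b (lone A) = b.
  by apply: ij_inj; rewrite -jiE i1 (lmul1 lL) (lmulr1 lL).
(* Two factorizations of j(b1) j(b2) i(a): in one step, or by moving i(a) past b2 and then past b1.
   Uniqueness yields an action law and a compatibility axiom at once; [E4] is the mirror case j(b)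
   i(a1) i(a2). *)
have E3 b1 b2 a : act (lmul b1 b2) a = act b1 (act b2 a) /\
    ract (lmul b1 b2) a = lmul (ract b1 (act b2 a)) (ract b2 a).
  apply: ij_inj; rewrite -jiE !jM -(lmulA lL) jiE (lmulA lL) jiE.
  by rewrite -(lmulA lL).
have E4 b a1 a2 : act b (lmul a1 a2) = lmul (act b a1) (act (ract b a1) a2) /\
    ract b (lmul a1 a2) = ract (ract b a1) a2.
  apply: ij_inj; rewrite -jiE !iM (lmulA lL) jiE -(lmulA lL) jiE.
  by rewrite (lmulA lL).
split=> //.
- by split=> [a|b1 b2 a]; [have [] := E1 a|have [] := E3 b1 b2 a].
- by split=> [b|b a1 a2]; [have [] := E2 b|have [] := E4 b a1 a2].
split=> [b a1 a2|b1 b2 a|b|a].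
- by have [] := E4 b a1 a2.
- by have [] := E3 b1 b2 a.
- by have [] := E2 b.
- by have [] := E1 a.
Qed.

Lemma factor_morph (x y : A * B) :
  lmul (i (lmul x.1 (act x.2 y.1))) (j (lmul (ract x.2 y.1) y.2)) =
  lmul (lmul (i x.1) (j x.2)) (lmul (i y.1) (j y.2)).
Proof.
rewrite iM jM -!(lmulA lL); congr lmul.
by rewrite !(lmulA lL) jiE.
Qed.

End Factorization.

(** * Coadjoint blocks and the explicit factorization in the cotangent group *)

Section CotangentOfMatchedPair.
Variables (R : realType) (G H : lieData R).
Variables (act : H -> G -> G) (ract : H -> G -> H).
Hypothesis hGH : matched_pair G H act ract.

Let K := matched_group act ract.
Let lG : is_lie_group G := mp_lieG hGH.
Let lH : is_lie_group H := mp_lieH hGH.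
Let lK : is_lie_group K := matched_group_lie hGH.
Let hG : is_manifold G := lie_manifold lG.
Let hH : is_manifold H := lie_manifold lH.
Let hK : is_manifold K := prodc_manifold hG hH.

Lemma matched_lmulE (x y : K) :
  lmul x y = (lmul x.1 (act x.2 y.1), lmul (ract x.2 y.1) y.2).
Proof. by []. Qed.

Lemma matched_linvE (x : K) :
  linv x = (act (linv x.2) (linv x.1), ract (linv x.2) (linv x.1)).
Proof. by []. Qed.

(** The merged map sends e_G to e_H for every [k]. The composite that defines [TR_Tsigma] goes
    through the tangent space at [k], where smoothness in [k] cannot be read off. *)
Lemma TR_TsigmaE k : TR_Tsigma ract k =
  tangent (M := G) (N := H) (fun g => lmul (ract k g) (linv k)) (lone G).
Proof.
have sR : smooth (M := H) (N := H) (fun x => lmul x (linv k)).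
  by apply: smooth_lmul => //; [exact: smooth_id|exact: smooth_cst].
rewrite (tangent_comp (lone G) hG hH hH (smooth_ract_r hGH k) sR).
by rewrite (mp_ract1 hGH).
Qed.

Lemma TL_TrhoE g : TL_Trho act g =
  tangent (M := H) (N := G) (fun h => lmul (linv g) (act h g)) (lone H).
Proof.
have sL : smooth (M := G) (N := G) (fun x => lmul (linv g) x).
  by apply: smooth_lmul => //; [exact: smooth_cst|exact: smooth_id].
rewrite (tangent_comp (lone H) hH hG hG (smooth_act_l hGH g) sL).
by rewrite (mp_act1 hGH).
Qed.

Lemma smooth_precomp_TR_Tsigma (M : charted R) (F : M -> H) (nu : M -> dualc R (cdim H)) :
  is_manifold M -> smooth F -> smooth nu ->
  smooth (M := M) (N := dualc R (cdim G))
    (fun x => precomp (nu x) (TR_Tsigma ract (F x))).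
Proof.
move=> hM sF snu; have hHG := prodc_manifold hH hG.
have hD := @dualc_manifold R.
have s : smooth (M := prodc H G) (N := H) (fun x => lmul (ract x.1 x.2) (linv x.1)).
  have sf := smooth_fst hH hG; have ss := smooth_snd hH hG.
  exact: (smooth_lmul lH hHG (smooth_ract hGH hHG sf ss) (smooth_linv lH hHG sf)).
have e k : lmul (ract k (lone G)) (linv k) = lone H.
  by rewrite (mp_ract1 hGH) (lmulrV lH).
have sp := smooth_precomp_tangent (F := fun k g => lmul (ract k g) (linv k)) hH hG hH s e.
pose op (k : H) (nu : dualc R (cdim H)) : dualc R (cdim G) :=
  precomp nu (tangent (M := G) (N := H) (fun g => lmul (ract k g) (linv k)) (lone G)).
have -> : (fun x => precomp (nu x) (TR_Tsigma ract (F x))) = (fun x => op (F x) (nu x)).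
  by apply/funext => x; rewrite TR_TsigmaE.
exact: (smooth_comp2 (op := op) hM hH (hD _) (hD _) sp sF snu).
Qed.

(** The double inverse is what unfolding [Ad] at an inverse produces, as [Adstar] requires. *)
Lemma conj_matched_H (h : H) (x : K) :
  lmul (lmul (linv (l := K) (lone G, h)) x) (linv (linv (l := K) (lone G, h))) =
  (act (linv h) x.1, lmul (lmul (ract (linv h) x.1) x.2) (linv (linv h))).
Proof.
rewrite (linvK lK) !matched_lmulE matched_linvE /=.
rewrite (linv1 lG) (mp_act_lone hGH) (mp_ract1 hGH) (lmul1 lG).
by rewrite (mp_act_lone hGH) (mp_ract1 hGH) (lmulr1 lG) (linvK lH).
Qed.

Lemma conj_matched_G (g : G) (x : K) :
  lmul (lmul (linv (l := K) (g, lone H)) x) (linv (linv (l := K) (g, lone H))) =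
  (lmul (lmul (linv g) x.1) (act x.2 g), ract x.2 g).
Proof.
rewrite (linvK lK) !matched_lmulE matched_linvE /=.
rewrite (linv1 lH) (mp_act1 hGH) (mp_ract_lone hGH) (mp_act1 hGH).
by rewrite (mp_ract_lone hGH) (lmul1 lH) (lmulr1 lH).
Qed.

Lemma Ad_matched_H h xi eta :
  Ad (linv (l := K) (lone G, h)) (row_mx xi eta) =
  row_mx (act_lie act (linv h) xi)
         (TR_Tsigma ract (linv h) xi + Ad (linv h) eta).
Proof.
set k := linv h; rewrite /Ad.
have -> : (fun x : K => lmul (lmul (linv (l := K) (lone G, h)) x)
                        (linv (linv (l := K) (lone G, h)))) =
    (fun x : K => (act k x.1, lmul (lmul (ract k x.1) x.2) (linv k))).
  by apply/funext => x; exact: conj_matched_H.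
have sf := smooth_fst hG hH; have ss := smooth_snd hG hH.
have sk := smooth_cst (M := K) (N := H) k hK hH.
have sk' := smooth_cst (M := K) (N := H) (linv k) hK hH.
have s1 : smooth (M := K) (N := G) (fun x => act k x.1).
  exact: (smooth_act hGH hK sk sf).
have s2 : smooth (M := K) (N := H) (fun x => lmul (lmul (ract k x.1) x.2) (linv k)).
  exact: (smooth_lmul lH hK (smooth_lmul lH hK (smooth_ract hGH hK sk sf) ss) sk').
rewrite (tangent_pair _ _ hK hG hH s1 s2); congr row_mx.
  rewrite (tangent_prodc (lone G) (lone H) xi eta hG hH hG s1) /=.
  (* The G component of the conjugation ignores the H variable: this is the zero block that makes Ad
     triangular. *)
  have c0 : tangent (M := H) (N := G) (fun=> act k (lone G)) (lone H) eta = 0.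
    by rewrite tangent_cst.
  rewrite c0 addr0. by [].
rewrite (tangent_prodc (lone G) (lone H) xi eta hG hH hH s2) /= TR_TsigmaE.
have -> : (fun x => lmul (lmul (ract k x) (lone H)) (linv k)) =
    (fun x => lmul (ract k x) (linv k)).
  by apply/funext => x; rewrite (lmulr1 lH).
by rewrite (mp_ract1 hGH).
Qed.

Lemma Ad_matched_G g xi eta :
  Ad (linv (l := K) (g, lone H)) (row_mx xi eta) =
  row_mx (Ad (linv g) xi + TL_Trho act g eta) (ract_lie ract g eta).
Proof.
rewrite /Ad.
have -> : (fun x : K => lmul (lmul (linv (l := K) (g, lone H)) x)
                        (linv (linv (l := K) (g, lone H)))) =
    (fun x : K => (lmul (lmul (linv g) x.1) (act x.2 g), ract x.2 g)).
  by apply/funext => x; exact: conj_matched_G.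
have sf := smooth_fst hG hH; have ss := smooth_snd hG hH.
have sg := smooth_cst (M := K) (N := G) g hK hG.
have sg' := smooth_cst (M := K) (N := G) (linv g) hK hG.
have s1 : smooth (M := K) (N := G) (fun x => lmul (lmul (linv g) x.1) (act x.2 g)).
  exact: (smooth_lmul lG hK (smooth_lmul lG hK sg' sf) (smooth_act hGH hK ss sg)).
have s2 : smooth (M := K) (N := H) (fun x => ract x.2 g).
  exact: (smooth_ract hGH hK ss sg).
rewrite (tangent_pair _ _ hK hG hH s1 s2); congr row_mx.
  rewrite (tangent_prodc (lone G) (lone H) xi eta hG hH hG s1) /= TL_TrhoE.
  have -> : (fun x => lmul (lmul (linv g) (lone G)) (act x g)) =
      (fun x => lmul (linv g) (act x g)).
    by apply/funext => x; rewrite (lmulr1 lG).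
  by rewrite (mp_act1 hGH) (linvK lG).
rewrite (tangent_prodc (lone G) (lone H) xi eta hG hH hH s2) /=.
have c0 : tangent (M := G) (N := H) (fun=> ract (lone H) g) (lone G) xi = 0.
  by rewrite tangent_cst.
by rewrite c0 add0r.
Qed.

(** Transposing the triangular matrix of [Ad_matched_H] carries its off-diagonal block to the dual
    of g. This is the origin of the T sigma term in (nu, g) |> (mu, h). *)
Lemma Adstar_matched_H h mu nu :
  Adstar (K := K) (lone G, h) (col_mx mu nu) =
  col_mx (dual_act act h mu + precomp nu (TR_Tsigma ract (linv h))) (Adstar h nu).
Proof.
apply/pairingP => v; rewrite -[v]hsubmxK; move: (lsubmx v) (rsubmx v) => xi eta.
rewrite [LHS]pairing_precomp_tangent [X in pairing _ X = _]Ad_matched_H.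
rewrite !pairing_col_row pairingDr pairingDl TR_TsigmaE.
by rewrite !pairing_precomp_tangent addrA.
Qed.

(** Here the off-diagonal block lands in the dual of h, which produces the term mu o TL o T rho. *)
Lemma Adstar_matched_G g mu nu :
  Adstar (K := K) (g, lone H) (col_mx mu nu) =
  col_mx (Adstar g mu) (precomp mu (TL_Trho act g) + dual_ract ract g nu).
Proof.
apply/pairingP => v; rewrite -[v]hsubmxK; move: (lsubmx v) (rsubmx v) => xi eta.
rewrite [LHS]pairing_precomp_tangent [X in pairing _ X = _]Ad_matched_G.
rewrite !pairing_col_row pairingDr pairingDl TL_TrhoE.
by rewrite !pairing_precomp_tangent addrA.
Qed.

Lemma precomp0 m n (T : 'rV[R]_m -> 'rV[R]_n) : precomp 0 T = 0.
Proof. by apply/colP => i; rewrite !mxE /pairing mulmx0 mxE. Qed.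

Lemma incl_gdual_HM (a1 a2 : gdual_H act) :
  incl_gdual_H ract (lmul a1 a2) = lmul (incl_gdual_H ract a1) (incl_gdual_H ract a2).
Proof.
case: a1 a2 => mu1 h1 [mu2 h2]; congr (_, (_, _)).
- rewrite [X in _ = _ + X]Adstar_matched_H /Adstar !precomp0 add_col_mx !addr0.
  by [].
- by rewrite /= (mp_act_lone hGH) (lmul1 lG).
- by rewrite /= (mp_ract1 hGH).
Qed.

Lemma incl_hdual_GM (b1 b2 : hdual_G ract) :
  incl_hdual_G act (lmul b1 b2) = lmul (incl_hdual_G act b1) (incl_hdual_G act b2).
Proof.
case: b1 b2 => nu1 g1 [nu2 g2]; congr (_, (_, _)).
- rewrite [X in _ = _ + X]Adstar_matched_G /Adstar !precomp0 add_col_mx !add0r.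
  by [].
- by rewrite /= (mp_act1 hGH).
- by rewrite /= (mp_ract_lone hGH) (lmul1 lH).
Qed.

Lemma incl_gdual_H_hdual_G (a : gdual_H act) (b : hdual_G ract) :
  lmul (incl_gdual_H ract a) (incl_hdual_G act b) =
  (col_mx (a.1 + precomp b.1 (TR_Tsigma ract (linv a.2))) (Adstar a.2 b.1),
   (act a.2 b.2, ract a.2 b.2)).
Proof.
case: a b => mu h [nu g]; congr (_, (_, _)).
- rewrite [X in _ + X = _]Adstar_matched_H /dual_act precomp0 add_col_mx !add0r.
  by [].
- by rewrite /= (lmul1 lG).
- by rewrite /= (lmulr1 lH).
Qed.

Lemma incl_hdual_G_gdual_H (a : gdual_H act) (b : hdual_G ract) :
  lmul (incl_hdual_G act b) (incl_gdual_H ract a) =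
  (col_mx (Adstar b.2 a.1) (b.1 + precomp a.1 (TL_Trho act b.2)), (b.2, a.2)).
Proof.
case: a b => mu h [nu g]; congr (_, (_, _)).
- rewrite [X in _ + X = _]Adstar_matched_G /dual_ract precomp0 add_col_mx add0r.
  by rewrite addr0.
- by rewrite /= (mp_act1 hGH) (lmulr1 lG).
- by rewrite /= (mp_ract1 hGH) (lmul1 lH).
Qed.

(* In K, (g, h) = (e, k^-1) (g', e) where k = h^-1 <| g^-1 and
   g' = (h^-1 |> g^-1)^-1. *)
Definition mult_inv (z : cotangent_group K) : gdual_H act * hdual_G ract :=
  let k := ract (linv z.2.2) (linv z.2.1) in
  let nu := Adstar k (dsubmx z.1) in
  ((usubmx z.1 - precomp nu (TR_Tsigma ract k), linv k),
   (nu, linv (act (linv z.2.2) (linv z.2.1)))).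

(** In K, (h |> g, h <| g) is the product (e, h)(g, e), whose inverse is (g^-1, e)(e, h^-1) = (g^-1,
    h^-1). Comparison with the formula for inverses in K gives both equations. *)
Lemma linv_act_ract h g :
  act (linv (ract h g)) (linv (act h g)) = linv g /\
  ract (linv (ract h g)) (linv (act h g)) = linv h.
Proof.
have : (linv g, linv h) = linv (l := K) (act h g, ract h g).
  apply: (lmul_eq1 lK); rewrite matched_lmulE /= -(mp_act_lmul hGH).
  by rewrite -(mp_ractM hGH) (lmulrV lG) (mp_act_lone hGH) (mp_ract1 hGH) (lmulrV lH).
by case=> -> ->.
Qed.

Lemma mult_mapK : cancel (mult_map act ract) mult_inv.
Proof.
case=> -[mu h] [nu g]; rewrite /mult_map incl_gdual_H_hdual_G /mult_inv /=.
have [-> ->] := linv_act_ract h g.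
rewrite col_mxKu col_mxKd (AdstarK lH) addrK.
by rewrite (linvK lG) (linvK lH).
Qed.

Lemma mult_invK : cancel mult_inv (mult_map act ract).
Proof.
case=> c [g h]; rewrite /mult_map incl_gdual_H_hdual_G /mult_inv /=.
(* Both equations are the components of the involutivity of the inverse of (g, h) in K. *)
have [e1 e2] : (act (linv (ract (linv h) (linv g))) (linv (act (linv h) (linv g))) = g) /\
   (ract (linv (ract (linv h) (linv g))) (linv (act (linv h) (linv g))) = h).
  by have := linvK lK (g, h); case.
by rewrite e1 e2 (linvK lH) subrK (AdstarK lH) vsubmxK.
Qed.

(** The group part of j(b) i(a) is just (g, h), so factoring it in the other order introduces k =
    h^-1 <| g^-1 and gives the stated formulas verbatim. *)
Lemma cot_actE (b : hdual_G ract) (a : gdual_H act) :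
  (cot_act act ract b a, cot_ract act ract b a) =
  mult_inv (lmul (incl_hdual_G act b) (incl_gdual_H ract a)).
Proof.
by rewrite incl_hdual_G_gdual_H; case: a b => mu h [nu g];
  rewrite /mult_inv /= col_mxKu col_mxKd.
Qed.

Let L := cotangent_group K.
Let A := gdual_H act.
Let B := hdual_G ract.
Let lL : is_lie_group L := cotangent_group_lie lK.
Let lA : is_lie_group A := gdual_H_lie hGH.
Let lB : is_lie_group B := hdual_G_lie hGH.
Let hL : is_manifold L := lie_manifold lL.
Let hA : is_manifold A := lie_manifold lA.
Let hB : is_manifold B := lie_manifold lB.

Lemma smooth_mult_inv : smooth (M := L) (N := prodc A B) mult_inv.
Proof.
have hD n := @dualc_manifold R n.
have sc := smooth_fst (hD (cdim G + cdim H)%N) hK.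
have sK := smooth_snd (hD (cdim G + cdim H)%N) hK.
have sg := smooth_linv lG hL (smooth_comp hL hK hG sK (smooth_fst hG hH)).
have sh := smooth_linv lH hL (smooth_comp hL hK hH sK (smooth_snd hG hH)).
have sk := smooth_ract hGH hL sh sg.
have sd := smooth_dualcL
  (dsubmx : {linear 'cV[R]_(cdim G + cdim H) -> 'cV[R]_(cdim H)}) hL sc.
have su := smooth_dualcL
  (usubmx : {linear 'cV[R]_(cdim G + cdim H) -> 'cV[R]_(cdim G)}) hL sc.
have snu := smooth_comp2 hL hH (hD _) (hD _) (smooth_Adstar lH) sk sd.
have sT := smooth_dualcL (-%R : {linear 'cV[R]_(cdim G) -> 'cV[R]_(cdim G)}) hL
  (smooth_precomp_TR_Tsigma hL sk snu).
have sA := smooth_pair hL (hD _) hH (smooth_dualcD hL su sT) (smooth_linv lH hL sk).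
have sB := smooth_pair hL (hD _) hG snu (smooth_linv lG hL (smooth_act hGH hL sh sg)).
exact: (smooth_pair hL hA hB sA sB).
Qed.

Lemma smooth_incl_gdual_H : smooth (M := A) (N := L) (@incl_gdual_H R G H act ract).
Proof.
have hD n := @dualc_manifold R n.
have s1 := smooth_fst (hD (cdim G)) hH; have s2 := smooth_snd (hD (cdim G)) hH.
have sc := smooth_dualcL (mulmx (col_mx 1%:M 0) :
  {linear 'cV[R]_(cdim G) -> 'cV[R]_(cdim G + cdim H)}) hA s1.
(* Padding by zero is written as a matrix product to display its linearity. *)
have -> : @incl_gdual_H R G H act ract =
    (fun a => (col_mx 1%:M 0 *m a.1, (lone G, a.2))).
  by apply/funext => a; rewrite mul_col_mx mul1mx mul0mx.
exact: (smooth_pair hA (hD _) hK sc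
  (smooth_pair hA hG hH (smooth_cst (lone G) hA hG) s2)).
Qed.

Lemma smooth_incl_hdual_G : smooth (M := B) (N := L) (@incl_hdual_G R G H act ract).
Proof.
have hD n := @dualc_manifold R n.
have s1 := smooth_fst (hD (cdim H)) hG; have s2 := smooth_snd (hD (cdim H)) hG.
have sc := smooth_dualcL (mulmx (col_mx 0 1%:M) :
  {linear 'cV[R]_(cdim H) -> 'cV[R]_(cdim G + cdim H)}) hB s1.
have -> : @incl_hdual_G R G H act ract =
    (fun b => (col_mx 0 1%:M *m b.1, (b.2, lone H))).
  by apply/funext => b; rewrite mul_col_mx mul1mx mul0mx.
exact: (smooth_pair hB (hD _) hK sc
  (smooth_pair hB hG hH s2 (smooth_cst (lone H) hB hH))).
Qed.

Lemma smooth_mult_map : smooth (M := prodc A B) (N := L) (mult_map act ract).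
Proof.
have hAB := prodc_manifold hA hB.
have s1 := smooth_comp hAB hA hL (smooth_fst hA hB) smooth_incl_gdual_H.
have s2 := smooth_comp hAB hB hL (smooth_snd hA hB) smooth_incl_hdual_G.
exact: (smooth_lmul lL hAB s1 s2).
Qed.

(** Both actions are treated at once as the factorization of j(b) i(a), so smoothness of the
    [TL_Trho] term is inherited from the product of the cotangent group. *)
Lemma smooth_cot_acts : smooth (M := prodc B A) (N := prodc A B)
  (fun x => (cot_act act ract x.1 x.2, cot_ract act ract x.1 x.2)).
Proof.
have hBA := prodc_manifold hB hA; have hAB := prodc_manifold hA hB.
have s1 := smooth_comp hBA hB hL (smooth_fst hB hA) smooth_incl_hdual_G.
have s2 := smooth_comp hBA hA hL (smooth_snd hB hA) smooth_incl_gdual_H.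
have -> : (fun x : prodc B A => (cot_act act ract x.1 x.2, cot_ract act ract x.1 x.2)) =
   (fun x : prodc B A => mult_inv (lmul (incl_hdual_G act x.1) (incl_gdual_H ract x.2))).
  by apply/funext => x; exact: cot_actE.
exact: (smooth_comp hBA hL hAB (smooth_lmul lL hBA s1 s2) smooth_mult_inv).
Qed.

Lemma incl_swap (b : B) (a : A) :
  lmul (incl_hdual_G act b) (incl_gdual_H ract a) =
  lmul (incl_gdual_H ract (cot_act act ract b a))
       (incl_hdual_G act (cot_ract act ract b a)).
Proof. by rewrite -[LHS]mult_invK -cot_actE. Qed.

Lemma cot_matched_pair : matched_pair A B (cot_act act ract) (cot_ract act ract).
Proof.
have hBA := prodc_manifold hB hA; have hAB := prodc_manifold hA hB.
apply: (matched_pair_factor lL lA lB incl_gdual_HM incl_hdual_GM _ incl_swap).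
(* Uniqueness of the factorization is the injectivity of [mult_map], which has the left inverse
   [mult_inv]. *)
- move=> a1 a2 b1 b2 e.
  have {}e : mult_map act ract (a1, b1) = mult_map act ract (a2, b2) by exact: e.
  have h := etrans (esym (mult_mapK (a1, b1)))
    (etrans (congr1 mult_inv e) (mult_mapK (a2, b2))).
  by split; [exact: (congr1 fst h)|exact: (congr1 snd h)].
- exact: (smooth_comp hBA hAB hA smooth_cot_acts (smooth_fst hA hB)).
- exact: (smooth_comp hBA hAB hB smooth_cot_acts (smooth_snd hA hB)).
Qed.

Lemma mult_map_iso :
  lie_group_iso (K := matched_group (cot_act act ract) (cot_ract act ract))
    (L := L) (mult_map act ract).
Proof.
split.
  move=> x y.
  exact: (factor_morph lL incl_gdual_HM incl_hdual_GM incl_swap).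
exists mult_inv; split; [exact: mult_mapK|exact: mult_invK|
  exact: smooth_mult_map|exact: smooth_mult_inv].
Qed.

End CotangentOfMatchedPair.

Theorem corollary2p3 (R : realType) (G H : lieData R)
    (act : H -> G -> G) (ract : H -> G -> H)
    (hGH : matched_pair G H act ract) :
  let K := matched_group act ract in
  let A := gdual_H act in
  let B := hdual_G ract in
  let bact : B -> A -> A := cot_act act ract in
  let bract : B -> A -> B := cot_ract act ract in
  [/\ is_lie_group K /\ is_lie_group (cotangent_group K),
      matched_pair A B bact bract,
      is_lie_group (matched_group bact bract),
      lie_group_iso (K := matched_group bact bract) (L := cotangent_group K)
        (mult_map act ract)
    & forall (a1 a2 : A) (b1 b2 : B),
        lmul (l := matched_group bact bract) (a1, b1) (a2, b2) =
        (lmul a1 (bact b1 a2), lmul (bract b1 a2) b2)].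
Proof.
have hK := matched_group_lie hGH; have hm := cot_matched_pair hGH.
split; [|exact: hm|exact: matched_group_lie hm|exact: mult_map_iso|by []].
by split; [exact: hK|exact: cotangent_group_lie].
Qed.
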